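(* There is an algorithm which, given a permutation $\pi$ of $\{1,\dots,n\}$, outputs a maximum induced matching of the permutation graph $G(\pi)$ in $\mathcal{O}(n^2)$ time.
   Context: For a permutation $\pi=(\pi(1),\dots,\pi(n))$ of $\{1,\dots,n\}$, $\pi^{-1}(i)$ denotes the position of $i$ in $\pi$. The permutation graph $G(\pi)=(V,E)$ has $V=\{1,\dots,n\}$ and $uv\in E$ iff $(u-v)(\pi^{-1}(u)-\pi^{-1}(v))<0$. An induced matching of a graph $G=(V,E)$ is a set $M\subseteq E$ such that for any two distinct edges $u_1v_1,u_2v_2\in M$, none of $u_1u_2,u_1v_2,v_1u_2,v_1v_2$ is in $E$. A maximum induced matching is one of maximum cardinality. Running times are in the standard RAM model. *)

(* Defs.v *)
From mathcomp Require Import all_boot fingroup perm.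
Set Implicit Arguments. Unset Strict Implicit. Unset Printing Implicit Defensive.

(* Permutation graphs.  Vertices 1..n of the paper are represented by  *)
(* 'I_n (vertex i : 'I_n stands for i+1); a permutation pi is a         *)
(* {perm 'I_n} mapping positions to values, so pi^-1 u is the position  *)
(* of u.                                                               *)

(* uv in E  iff  (u - v)(pi^-1(u) - pi^-1(v)) < 0, written sign-wise. *)
Definition perm_adj (n : nat) (pi : {perm 'I_n}) (u v : 'I_n) : bool :=
  ((u < v) && ((pi^-1)%g v < (pi^-1)%g u)) ||
  ((v < u) && ((pi^-1)%g u < (pi^-1)%g v)).

Definition perm_edges (n : nat) (pi : {perm 'I_n}) : {set {set 'I_n}} :=
  [set e : {set 'I_n} | [exists u, exists v, (e == [set u; v]) && perm_adj pi u v]].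

Definition induced_matching (n : nat) (pi : {perm 'I_n}) (M : {set {set 'I_n}}) : Prop :=
  M \subset perm_edges pi /\
  forall e1 e2, e1 \in M -> e2 \in M -> e1 != e2 ->
    forall x y, x \in e1 -> y \in e2 -> ~~ perm_adj pi x y.

Definition maximum_induced_matching (n : nat) (pi : {perm 'I_n}) (M : {set {set 'I_n}}) : Prop :=
  induced_matching pi M /\
  forall M', induced_matching pi M' -> #|M'| <= #|M|.

(* A standard unit-cost RAM: countably many registers holding naturals, *)
(* instructions: constant, addition, truncated subtraction, indirect    *)
(* load/store, jump, jump-if-zero, halt.  Each executed instruction     *)
(* costs one time step.                                                 *)

Inductive instr : Type :=
| IConst of nat & nat        (* IConst r k   : M[r] := k                 *)
| IAdd of nat & nat & nat    (* IAdd r a b   : M[r] := M[a] + M[b]       *)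
| ISub of nat & nat & nat    (* ISub r a b   : M[r] := M[a] - M[b] (trunc)*)
| ILoad of nat & nat         (* ILoad r a    : M[r] := M[M[a]]           *)
| IStore of nat & nat        (* IStore a b   : M[M[a]] := M[b]           *)
| IJmp of nat                (* IJmp l       : pc := l                   *)
| IJz of nat & nat           (* IJz a l      : if M[a] = 0 then pc := l  *)
| IHalt.

Definition memory := nat -> nat.
Definition config := (nat * memory)%type.

Definition upd (m : memory) (a v : nat) : memory :=
  fun x => if x == a then v else m x.

(* One step; None means the machine has halted (IHalt or pc outside the
   program). *)
Definition step (p : seq instr) (c : config) : option config :=
  let: (pc, m) := c in
  if pc < size p then
    match nth IHalt p pc with
    | IConst r k => Some (pc.+1, upd m r k)
    | IAdd r a b => Some (pc.+1, upd m r (m a + m b))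
    | ISub r a b => Some (pc.+1, upd m r (m a - m b))
    | ILoad r a => Some (pc.+1, upd m r (m (m a)))
    | IStore a b => Some (pc.+1, upd m (m a) (m b))
    | IJmp l => Some (l, m)
    | IJz a l => Some (if m a == 0 then l else pc.+1, m)
    | IHalt => None
    end
  else None.

(* run p t c = Some m  iff the machine started in c halts after at most t
   executed instructions with final memory m. *)
Fixpoint run (p : seq instr) (t : nat) (c : config) : option memory :=
  match step p c with
  | None => Some c.2
  | Some c' => match t with 0 => None | t'.+1 => run p t' c' end
  end.

(* Input encoding: M[0] = n, M[i] = pi(i) for 1 <= i <= n (values in 1..n),
   all other registers 0. *)
Definition init_mem (n : nat) (pi : {perm 'I_n}) : memory :=
  fun a => if a == 0 then n else
    match (insub a.-1 : option 'I_n) with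
    | Some i => (pi i).+1
    | None => 0
    end.

(* Output encoding: M[0] = k, and for i < k the i-th edge is
   {M[2i+1], M[2i+2]} (vertices in 1..n). *)
Definition output_wf (n : nat) (m : memory) : Prop :=
  forall i, i < m 0 -> 0 < m (i.*2.+1) <= n /\ 0 < m (i.*2.+2) <= n.

Definition decode_output (n : nat) (m : memory) : {set {set 'I_n}} :=
  [set e : {set 'I_n} | [exists i : 'I_(m 0), exists u : 'I_n, exists v : 'I_n,
     [&& (u.+1 == m (val i).*2.+1), (v.+1 == m (val i).*2.+2) & (e == [set u; v])]]].

(* Main.v *)
Require Import Defs.
From mathcomp Require Import all_boot fingroup perm zify.

(* View the value v in position i as the point (i, v): an edge is a pair of points,
   one to the upper left of the other. Two edges are induced-independent iff all
   points of one lie to the lower left of all points of the other, so induced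
   matchings are chains of edges. A longest chain among the points with positions
   <= i and values <= v either avoids position i, or avoids the value v, or its last
   edge joins the point in position i to the point of value v; so its length is
     F i v = max (F (i-1) v) (F i (v-1)) (F (pos v - 1) (pi i - 1) + 1),
   the last term being present when pos v < i and pi i < v. A program whose loops
   all run n times fills the table of F with two nested loops, and traces a longest
   chain back from (n, n) in 2n steps. *)

Set Implicit Arguments. Unset Strict Implicit. Unset Printing Implicit Defensive.

(** * Longest chains *)

Definition cancel_upto (n : nat) (f g : nat -> nat) : Prop :=
  forall i, 0 < i <= n -> 0 < f i <= n /\ g (f i) = i.

Definition endpoints (l : seq (nat * nat)) : seq nat :=
  flatten [seq [:: e.1; e.2] | e <- l].

Lemma endpoints_rcons l e : endpoints (rcons l e) = rcons (rcons (endpoints l) e.1) e.2.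
Proof. by rewrite /endpoints map_rcons flatten_rcons -!cats1 -catA. Qed.

Lemma size_endpoints l : size (endpoints l) = (size l).*2.
Proof. by elim: l => //= e l ->. Qed.

Lemma nth_endpoints l j : j < size l ->
  nth (0, 0) l j = (nth 0 (endpoints l) j.*2, nth 0 (endpoints l) j.*2.+1).
Proof. by elim: l j => [|[w x] l IH] [|j] //= /IH. Qed.

Definition encoding (l : seq (nat * nat)) : seq nat := size l :: endpoints l.

Section Chains.
Variables value pos : nat -> nat.

(* [(w, x)] is the edge between the values [w < x], so that the position of [x]
   comes first; edges are listed from top right to bottom left. *)
Fixpoint chain (i v : nat) (l : seq (nat * nat)) : bool :=
  if l is (w, x) :: l' then
    [&& 0 < w < x, x <= v, 0 < pos x < pos w, pos w <= i & chain (pos x).-1 w.-1 l']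
  else true.

Lemma chain_mono i v i' v' l : i <= i' -> v <= v' -> chain i v l -> chain i' v' l.
Proof. by case: l => [|[w x] l] //= le_i le_v /and5P[-> ? -> ? ->]; rewrite andbT /=; lia. Qed.

Lemma chain_size i v l : chain i v l -> (size l).*2 <= v.
Proof.
elim: l i v => [|[w x] l IH] i v //= /and5P[lt_wx le_xv _ _ /IH]; lia.
Qed.

Lemma chain_mem i v l w x : chain i v l -> (w, x) \in l -> 0 < w < x /\ x <= v.
Proof.
elim: l i v => [|[w' x'] l IH] i v //= /and5P[lt_wx le_x _ _ ch].
rewrite in_cons => /predU1P[[-> ->] //|/(IH _ _ ch)]; lia.
Qed.

Definition longest (T : Type) (l1 l2 : seq T) : seq T :=
  if size l1 < size l2 then l2 else l1.

Lemma size_longest (T : Type) (l1 l2 : seq T) :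
  size (longest l1 l2) = maxn (size l1) (size l2).
Proof. by rewrite /longest /maxn; case: ifP. Qed.

Fixpoint best_rec (d i v : nat) : seq (nat * nat) :=
  match d, i, v with
  | d'.+1, i'.+1, v'.+1 =>
      let shorter := longest (best_rec d' i' v) (best_rec d' i v') in
      if (pos v < i) && (value i < v) then
        longest shorter ((value i, v) :: best_rec d' (pos v).-1 (value i).-1)
      else shorter
  | _, _, _ => [::]
  end.

Definition best (i v : nat) : seq (nat * nat) := best_rec (i + v) i v.

Lemma best_rec_fuel d d' i v : i + v <= d -> i + v <= d' ->
  best_rec d i v = best_rec d' i v.
Proof.
elim: d d' i v => [|d IH] [|d'] [|i] [|v] //= le_d le_d'.
rewrite (IH d' i v.+1) ?(IH d' i.+1 v); try lia.
by case: ifP => // /andP[lt_p lt_w]; rewrite (IH d') //; lia.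
Qed.

Lemma best_recE d i v : i + v <= d -> best_rec d i v = best i v.
Proof. by move=> le_d; apply: best_rec_fuel. Qed.

Lemma best_row0 v : best 0 v = [::].
Proof. by case: v. Qed.

Lemma best_col0 i : best i 0 = [::].
Proof. by rewrite /best; case: i => //= i; case: (i + 0). Qed.

Lemma bestSS i v :
  let shorter := longest (best i v.+1) (best i.+1 v) in
  best i.+1 v.+1 =
    if (pos v.+1 < i.+1) && (value i.+1 < v.+1) then
      longest shorter ((value i.+1, v.+1) :: best (pos v.+1).-1 (value i.+1).-1)
    else shorter.
Proof.
rewrite /= {1}/best addSn /= (best_recE (i := i)) ?(best_recE (v := v)); try lia.
by case: ifP => // /andP[lt_p lt_w]; rewrite best_recE //; lia.
Qed.

Lemma best_traceback i v :
  let k := size (best i.+1 v.+1) in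
  best i.+1 v.+1 =
    if k <= size (best i v.+1) then best i v.+1
    else if k <= size (best i.+1 v) then best i.+1 v
    else (value i.+1, v.+1) :: best (pos v.+1).-1 (value i.+1).-1.
Proof.
have [/leq_trans le_trans|] := leqP (size (best i v.+1)) (size (best i.+1 v)).
all: rewrite bestSS /longest; do !case: ifP => //=; lia.
Qed.

Variable n : nat.
Hypothesis valueK : cancel_upto n value pos.
Hypothesis posK : cancel_upto n pos value.

Lemma best_chain i v : i <= n -> v <= n -> chain i v (best i v).
Proof.
have [d] := ubnP (i + v); elim: d i v => // d IH [|i] [|v] lt_d le_i le_v;
  rewrite ?best_row0 ?best_col0 // bestSS.
have [lo_w pos_w] := @valueK i.+1 le_i; have [lo_p _] := @posK v.+1 le_v.
have up : chain i.+1 v.+1 (best i v.+1) by apply: chain_mono (IH _ _ _ _ _) => //; lia.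
have left : chain i.+1 v.+1 (best i.+1 v) by apply: chain_mono (IH _ _ _ _ _) => //; lia.
rewrite /longest; case: ifP => [/andP[lt_p lt_w]|_]; last by case: ifP.
have diag : chain (pos v.+1).-1 (value i.+1).-1 (best (pos v.+1).-1 (value i.+1).-1).
  by apply: IH; lia.
by case: ifP => _; [rewrite /= pos_w diag; lia | case: ifP].
Qed.

(* A chain whose first edge lies neither in positions [<= i] nor in values [<= v]
   starts with the edge between the point in position [i.+1] and the value [v.+1]:
   there is a single candidate. *)
Lemma best_max i v l : i <= n -> v <= n -> chain i v l -> size l <= size (best i v).
Proof.
have [d] := ubnP (i + v); elim: d i v l => // d IH [|i] [|v] [|[w x] l] lt_d le_i le_v //=.
1-3: by lia.
case/and5P=> lt_wx le_xv lt_pos le_pos ch; rewrite bestSS.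
have [_ val_w] := @posK w (ltac:(lia)).
have [le_wi|gt_wi] := leqP (pos w) i.
  have := IH i v.+1 ((w, x) :: l); rewrite /= lt_wx le_xv lt_pos ch le_wi.
  case: ifP => _; rewrite !size_longest; lia.
have [le_xv'|gt_xv] := leqP x v.
  have := IH i.+1 v ((w, x) :: l); rewrite /= lt_wx le_xv' lt_pos ch le_pos.
  case: ifP => _; rewrite !size_longest; lia.
have eq_x : x = v.+1 by lia.
have eq_pos : pos w = i.+1 by lia.
subst x; rewrite eq_pos in val_w lt_pos; rewrite val_w ifT; last by lia.
by have := IH _ _ l _ _ _ ch; rewrite size_longest /=; lia.
Qed.

End Chains.

(** * Chains and induced matchings *)

Section Graph.
Variables (n : nat) (pi : {perm 'I_n}).
Implicit Types M : {set {set 'I_n}}.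

Definition position (x : nat) : nat :=
  if (insub x.-1 : option 'I_n) is Some u then ((pi^-1)%g u).+1 else 0.

Lemma ord_of_pos x : 0 < x <= n -> exists u : 'I_n, x = u.+1.
Proof. by case: x => // x lt_x; exists (Ordinal lt_x). Qed.

Lemma position_ord (u : 'I_n) : position u.+1 = ((pi^-1)%g u).+1.
Proof. by rewrite /position /= valK. Qed.

Lemma init_mem_ord (i : 'I_n) : init_mem pi i.+1 = (pi i).+1.
Proof. by rewrite /init_mem /= valK. Qed.

Lemma init_memK : cancel_upto n (init_mem pi) position.
Proof.
case=> // i lt_i; rewrite (init_mem_ord (Ordinal lt_i)) position_ord permK.
by rewrite /= ltn_ord.
Qed.

Lemma positionK : cancel_upto n position (init_mem pi).
Proof.
case=> // x lt_x; rewrite (position_ord (Ordinal lt_x)) init_mem_ord permKV.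
by rewrite /= ltn_ord.
Qed.

Definition edge_of (e : nat * nat) : {set 'I_n} :=
  [set u : 'I_n | (u.+1 == e.1) || (u.+1 == e.2)].

Definition edges_of (l : seq (nat * nat)) : {set {set 'I_n}} :=
  [set e in [seq edge_of x | x <- l]].

Lemma edge_ofE (u v : 'I_n) : edge_of (u.+1, v.+1) = [set u; v].
Proof. by apply/setP => x; rewrite !inE /= !eqSS. Qed.

Lemma edges_of_nil : edges_of [::] = set0.
Proof. by apply/setP=> e; rewrite !inE. Qed.

Lemma edges_of_cons e l : edges_of (e :: l) = edge_of e |: edges_of l.
Proof. by apply/setP=> f; rewrite !inE. Qed.

Definition inversion (u v : 'I_n) : bool := (u < v) && ((pi^-1)%g v < (pi^-1)%g u).

Definition confined i v (M : {set {set 'I_n}}) : Prop :=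
  forall e u, e \in M -> u \in e -> u < v /\ (pi^-1)%g u < i.

Lemma perm_adjC (u v : 'I_n) : perm_adj pi u v = perm_adj pi v u.
Proof. by rewrite /perm_adj orbC. Qed.

Lemma nonadjacent_positions (u v : 'I_n) : u < v -> ~~ perm_adj pi u v ->
  (pi^-1)%g u < (pi^-1)%g v.
Proof.
move=> lt_uv; rewrite /perm_adj lt_uv /= ltnNge negb_or => /andP[].
rewrite negbK leq_eqVlt => /orP[/eqP/val_inj/perm_inj eq_uv|//].
by rewrite eq_uv ltnn in lt_uv.
Qed.

Lemma perm_edgesP (e : {set 'I_n}) :
  reflect (exists2 uv, e = [set uv.1; uv.2] & inversion uv.1 uv.2) (e \in perm_edges pi).
Proof.
rewrite inE; apply: (iffP existsP) => [[u /existsP[v /andP[/eqP-> ]]]|].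
  by case/orP=> inv_uv; [exists (u, v) | exists (v, u); rewrite 1?setUC].
case=> -[u v] /= -> inv_uv; exists u; apply/existsP; exists v.
by rewrite eqxx /perm_adj -/(inversion u v) inv_uv.
Qed.

Lemma induced_matching0 : induced_matching pi set0.
Proof. by split; [apply: sub0set | move=> e1 e2; rewrite inE]. Qed.

Lemma induced_matchingU1 e M : e \in perm_edges pi ->
  (forall f y z, f \in M -> y \in e -> z \in f -> ~~ perm_adj pi y z) ->
  induced_matching pi M -> induced_matching pi (e |: M).
Proof.
move=> edge_e sep [sub ind]; split; first by rewrite subUset sub1set edge_e.
move=> f1 f2; rewrite !in_setU1 => /predU1P[->|f1M] /predU1P[->|f2M] neq y z.
- by rewrite eqxx in neq.
- exact: sep.
- by move=> y_f1 z_e; rewrite perm_adjC; apply: sep z_e y_f1.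
- exact: ind.
Qed.

Lemma chain_edges i v l : v <= n -> chain position i v l ->
  [/\ induced_matching pi (edges_of l), #|edges_of l| = size l & confined i v (edges_of l)].
Proof.
elim: l i v => [|[w x] l IH] i v le_vn /=.
  move=> _; rewrite edges_of_nil cards0; split=> //; first exact: induced_matching0.
  by move=> e u; rewrite inE.
case/and5P=> /andP[w_gt0 lt_wx] le_xv lt_pos le_wi ch.
have [a eq_w] : exists a : 'I_n, w = a.+1 by apply: ord_of_pos; lia.
have [b eq_x] : exists b : 'I_n, x = b.+1 by apply: ord_of_pos; lia.
subst w x; rewrite !position_ord /= in lt_wx le_xv lt_pos le_wi ch.
have [ind card conf] := IH _ _ (ltnW (ltn_ord a)) ch.
have a_e : a \in [set a; b] by rewrite !inE eqxx.
rewrite edges_of_cons edge_ofE; split.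
- apply: induced_matchingU1 => //.
    by apply/perm_edgesP; exists (a, b); rewrite // /inversion /=; lia.
  move=> f y z fM y_e z_f; have [lt_z lt_pz] := conf f z fM z_f.
  by move: y_e; rewrite /perm_adj !inE => /orP[]/eqP->; lia.
- rewrite cardsU1 card; case: (boolP (_ \in _)) => // e_l.
  by have [] := conf _ a e_l a_e; rewrite ltnn.
- move=> f y; rewrite in_setU1 => /predU1P[->|f_l y_f].
    by rewrite !inE => /orP[]/eqP->; split=> //; lia.
  by have [] := conf f y f_l y_f; lia.
Qed.

(* Two points of distinct edges of an induced matching are not adjacent, so their
   positions are in the order of their values: the edge with the larger top value
   lies entirely to the upper right of the other. *)
Lemma separated_inversions (w x w' x' : 'I_n) : inversion w x -> inversion w' x' -> x' <= x ->
  (forall y z, y \in [set w'; x'] -> z \in [set w; x] -> ~~ perm_adj pi y z) ->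
  x' < w /\ (pi^-1)%g w' < (pi^-1)%g x.
Proof.
move=> /andP[lt_wx lt_pos] /andP[lt_wx' lt_pos'] le_xx' sep.
have [w_e x_e] : w \in [set w; x] /\ x \in [set w; x] by rewrite !inE !eqxx orbT.
have [w_e' x_e'] : w' \in [set w'; x'] /\ x' \in [set w'; x'] by rewrite !inE !eqxx orbT.
have lt_xx' : x' < x.
  rewrite ltn_neqAle le_xx' andbT; apply: contraTN (sep _ _ x_e' w_e).
  by move=> /eqP/val_inj->; rewrite negbK /perm_adj lt_wx lt_pos orbT.
have lt_w : x' < w.
  have lt_p := nonadjacent_positions lt_xx' (sep _ _ x_e' x_e).
  have := sep _ _ x_e' w_e.
  case: (ltngtP x' w) => // [lt_w|/val_inj eq_w]; last by rewrite eq_w in lt_p; lia.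
  by rewrite perm_adjC => /(nonadjacent_positions lt_w); lia.
by split=> //; apply: nonadjacent_positions (sep _ _ w_e' x_e); lia.
Qed.

Lemma exists_top_edge M : M \subset perm_edges pi -> M != set0 ->
  exists w x : 'I_n, [/\ [set w; x] \in M, inversion w x &
    forall w' x', [set w'; x'] \in M -> x' <= x].
Proof.
move=> sub /set0Pn[e0 e0M]; pose top (e : {set 'I_n}) := \max_(u in e) (u : nat).
have [e eM max_e] : exists2 e, e \in M & forall f, f \in M -> top f <= top e.
  by case: (arg_maxnP top e0M) => e eM max_e; exists e.
have /perm_edgesP[[w x] /= eE inv_wx] := subsetP sub e eM.
exists w, x; rewrite -eE; split=> // w' x' /max_e.
have -> : top e = x.
  rewrite /top eE big_setU1 ?big_set1 /=; first by case/andP: inv_wx; lia.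
  by rewrite inE; apply/eqP=> eq_wx; case/andP: inv_wx; rewrite eq_wx ltnn.
by apply: leq_trans; rewrite (bigmax_sup x') // !inE eqxx orbT.
Qed.

Lemma matching_chain i v M : induced_matching pi M -> confined i v M ->
  exists2 l, chain position i v l & size l = #|M|.
Proof.
have [k] := ubnP #|M|; elim: k M i v => // k IH M i v lt_k [sub ind] conf.
have [->|/(exists_top_edge sub)[w [x [eM inv_wx top_x]]]] := eqVneq M set0.
  by exists [::]; rewrite ?cards0.
set e := [set w; x] in eM *.
have below : confined ((pi^-1)%g x) w (M :\ e).
  move=> f y; rewrite !inE => /andP[neq fM] y_f.
  have /perm_edgesP[[w' x'] /= fE inv_wx'] := subsetP sub f fM.
  rewrite fE in y_f fM neq.
  have [] := separated_inversions inv_wx inv_wx' (top_x _ _ fM) (ind _ _ fM eM neq).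
  case/andP: inv_wx' => lt_wx' lt_pos'.
  by move: y_f; rewrite !inE => /orP[]/eqP->; lia.
have [] := IH (M :\ e) _ _ _ _ below.
- by move: lt_k; rewrite (cardsD1 e M) eM.
- split; first by apply: subset_trans sub; apply: subsetDl.
  by move=> f1 f2; rewrite !inE => /andP[_ ?] /andP[_ ?]; apply: ind.
move=> l ch_l size_l; exists ((w.+1, x.+1) :: l); last by rewrite (cardsD1 e M) eM /= size_l.
have [lt_x _] : x < v /\ (pi^-1)%g x < i by apply: conf eM _; rewrite !inE eqxx orbT.
have [_ lt_w] : w < v /\ (pi^-1)%g w < i by apply: conf eM _; rewrite !inE eqxx.
by case/andP: inv_wx => lt_wx lt_pos; rewrite /= !position_ord ch_l /=; lia.
Qed.

End Graph.

(** * Runs of the machine *)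

Arguments step : simpl never.

Definition reaches (p : seq instr) (t : nat) (c c' : config) : Prop :=
  exists2 t', t' <= t & iter t' (obind (step p)) (Some c) = Some c'.

Lemma reaches_refl p c : reaches p 0 c c.
Proof. by exists 0. Qed.

Lemma reaches_step p c c' : step p c = Some c' -> reaches p 1 c c'.
Proof. by move=> step_c; exists 1. Qed.

Lemma reaches_trans p t1 t2 c1 c2 c3 :
  reaches p t1 c1 c2 -> reaches p t2 c2 c3 -> reaches p (t1 + t2) c1 c3.
Proof.
move=> [u1 le_u1 run1] [u2 le_u2 run2]; exists (u2 + u1); first by lia.
by rewrite iterD run1.
Qed.

Lemma reaches_leq p t t' c c' : t <= t' -> reaches p t c c' -> reaches p t' c c'.
Proof. by move=> le_t [u le_u run_u]; exists u => //; apply: leq_trans le_t. Qed.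

Lemma reaches_run p t c c' :
  reaches p t c c' -> step p c' = None -> run p t c = Some c'.2.
Proof.
move=> [u le_u run_u] halt; elim: u t c le_u run_u => [|u IH] t c le_u.
  by move=> [->]; case: t {le_u} => [|t] /=; rewrite halt.
rewrite iterSr /=; case: t le_u => // t le_u; case step_c: (step p c) => [c1|] /=.
  by rewrite step_c; apply: IH.
by rewrite iter_fix.
Qed.

Definition code_at (p : seq instr) (o : nat) (l : seq instr) : Prop :=
  exists pre post, size pre = o /\ p = pre ++ l ++ post.

Lemma code_at_whole p : code_at p 0 p.
Proof. by exists [::], [::]; rewrite cats0. Qed.

Lemma code_at_catl p o l1 l2 : code_at p o (l1 ++ l2) -> code_at p o l1.
Proof. by case=> pre [post [so ->]]; exists pre, (l2 ++ post); rewrite -catA. Qed.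

Lemma code_at_catr p o l1 l2 : code_at p o (l1 ++ l2) -> code_at p (o + size l1) l2.
Proof.
by case=> pre [post [<- ->]]; exists (pre ++ l1), post; rewrite size_cat -!catA.
Qed.

Lemma code_at_behead p o i l : code_at p o (i :: l) -> code_at p o.+1 l.
Proof. by rewrite -cat1s -[o.+1]addn1 => /code_at_catr. Qed.

Definition straight (i : instr) : bool :=
  if i is (IJmp _ | IJz _ _ | IHalt) then false else true.

Definition effect (m : memory) (i : instr) : memory :=
  match i with
  | IConst r k => upd m r k
  | IAdd r a b => upd m r (m a + m b)
  | ISub r a b => upd m r (m a - m b)
  | ILoad r a => upd m r (m (m a))
  | IStore a b => upd m (m a) (m b)
  | _ => m
  end.

Lemma code_at_step p o i l m : code_at p o (i :: l) ->
  step p (o, m) =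
  match i with
  | IJmp o' => Some (o', m)
  | IJz a o' => Some (if m a == 0 then o' else o.+1, m)
  | IHalt => None
  | _ => Some (o.+1, effect m i)
  end.
Proof.
case=> pre [post [<- ->]].
rewrite /step size_cat /= -[X in X < _]addn0 ltn_add2l nth_cat ltnn subnn /=.
by case: i.
Qed.

Definition run_block (l : seq instr) (m : memory) : memory := foldl effect m l.

Lemma run_block_cat l1 l2 m : run_block (l1 ++ l2) m = run_block l2 (run_block l1 m).
Proof. exact: foldl_cat. Qed.

Lemma reaches_block p o l m : all straight l -> code_at p o l ->
  reaches p (size l) (o, m) (o + size l, run_block l m).
Proof.
elim: l o m => [|i l IH] o m /=; first by rewrite addn0 => *; apply: reaches_refl.
case/andP=> straight_i straight_l code.
rewrite -[(size l).+1]add1n addnA addn1.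
apply: reaches_trans (reaches_step _) (IH _ _ straight_l (code_at_behead code)).
by rewrite (code_at_step _ code); case: i straight_i {code}.
Qed.

Lemma upd_eq (m : memory) a x b : b = a -> upd m a x b = x.
Proof. by move->; rewrite /upd eqxx. Qed.

Lemma upd_neq (m : memory) a x b : b <> a -> upd m a x b = m b.
Proof. by rewrite /upd; case: eqP. Qed.

(** * A language of bounded loops *)

(* The registers below [nvar] hold variables and those from [nvar] to [nreg] are
   temporaries. Cell [a] of the heap is register [nreg + a]: the heap, the variables
   and the temporaries are disjoint whatever addresses a program computes. *)
Definition nvar := 8.
Definition nreg := 16.

Inductive var : Type := VarId of nat.

Definition reg (x : var) : nat := let: VarId r := x in r.

Notation vsize := (VarId 0).

Inductive expr : Type :=
| Cst of nat
| Var of var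
| Add of expr & expr
| Sub of expr & expr
| Read of expr.

Coercion Cst : nat >-> expr.
Coercion Var : var >-> expr.

Declare Scope expr_scope.
Delimit Scope expr_scope with E.
Bind Scope expr_scope with expr.
Notation "a + b" := (Add a b) : expr_scope.
Notation "a - b" := (Sub a b) : expr_scope.

Inductive cmd : Type :=
| Skip
| Assign of var & expr
| Write of expr & expr
| Seq of cmd & cmd
| If of expr & cmd & cmd
| For of var & cmd.

Notation "c1 ;; c2" := (Seq c1 c2) (at level 90, right associativity).

Definition When (e : expr) (c : cmd) : cmd := If e c Skip.

Definition state : Type := memory * memory.

Definition assign (s : state) (x : var) (k : nat) : state :=
  (fun r => if r == reg x then k else s.1 r, s.2).

Fixpoint eval (s : state) (e : expr) : nat :=
  match e with
  | Cst k => k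
  | Var x => s.1 (reg x)
  | Add a b => eval s a + eval s b
  | Sub a b => eval s a - eval s b
  | Read a => s.2 (eval s a)
  end.

Fixpoint exec (c : cmd) (s : state) : state :=
  match c with
  | Skip => s
  | Assign x e => assign s x (eval s e)
  | Write a e => (s.1, upd s.2 (eval s a) (eval s e))
  | Seq c1 c2 => exec c2 (exec c1 s)
  | If e c1 c2 => if eval s e == 0 then exec c2 s else exec c1 s
  | For x c =>
      iteri (s.1 (reg vsize)) (fun k s' => exec c (assign s' x k.+1)) (assign s x 0)
  end.

Fixpoint assigned (c : cmd) : seq nat :=
  match c with
  | Skip | Write _ _ => [::]
  | Assign x _ => [:: reg x]
  | Seq c1 c2 | If _ c1 c2 => assigned c1 ++ assigned c2
  | For x c => reg x :: assigned c
  end.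

Lemma eval_Cst s k : eval s (Cst k) = k.
Proof. by []. Qed.

Lemma eval_Var s x : eval s (Var x) = s.1 (reg x).
Proof. by []. Qed.

Lemma eval_Add s a b : eval s (a + b)%E = eval s a + eval s b.
Proof. by []. Qed.

Lemma eval_Sub s a b : eval s (a - b)%E = eval s a - eval s b.
Proof. by []. Qed.

Lemma eval_Read s a : eval s (Read a) = s.2 (eval s a).
Proof. by []. Qed.

Definition evalE := (eval_Cst, eval_Var, eval_Add, eval_Sub, eval_Read).

Lemma exec_Assign s x e : exec (Assign x e) s = assign s x (eval s e).
Proof. by []. Qed.

Lemma exec_Write s a e : exec (Write a e) s = (s.1, upd s.2 (eval s a) (eval s e)).
Proof. by []. Qed.

Lemma exec_Seq s c1 c2 : exec (c1 ;; c2) s = exec c2 (exec c1 s).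
Proof. by []. Qed.

Lemma exec_If s e c1 c2 :
  exec (If e c1 c2) s = if 0 < eval s e then exec c1 s else exec c2 s.
Proof. by rewrite /= lt0n; case: eqP. Qed.

Lemma exec_When s e c : exec (When e c) s = if 0 < eval s e then exec c s else s.
Proof. exact: exec_If. Qed.

Definition execE := (exec_Assign, exec_Write, exec_Seq, exec_If, exec_When).

Lemma exec_unassigned c s r : r \notin assigned c -> (exec c s).1 r = s.1 r.
Proof.
elim: c s => [|x e|a e|c1 IH1 c2 IH2|e c1 IH1 c2 IH2|x c IH] s //=.
- by rewrite inE => /negPf->.
- by rewrite mem_cat negb_or => /andP[free1 free2]; rewrite IH2 ?IH1.
- by rewrite mem_cat negb_or => /andP[free1 free2]; case: ifP => _; [apply: IH2 | apply: IH1].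
rewrite inE negb_or => /andP[/negPf neq_r free].
by elim: (s.1 0) => [|k IHk] /=; rewrite ?IH //= neq_r.
Qed.

Lemma exec_For (I : nat -> state -> Prop) n x c s :
  s.1 (reg vsize) = n -> I 0 (assign s x 0) ->
  (forall k s', k < n -> I k s' -> I k.+1 (exec c (assign s' x k.+1))) ->
  I n (exec (For x c) s).
Proof.
move=> /= -> I0 IS; move: (leqnn n); move: {-2}n => k.
elim: k => //= k IH lt_k; exact: IS (IH (ltnW lt_k)).
Qed.

(** * Compilation *)

Fixpoint fits (d : nat) (e : expr) : bool :=
  match e with
  | Cst _ => d < nreg
  | Var x => (reg x < nvar) && (d < nreg)
  | Add a b | Sub a b => fits d a && fits d.+1 b
  | Read a => fits d a && (d.+1 < nreg)
  end.

Fixpoint well_formed (c : cmd) : bool :=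
  match c with
  | Skip => true
  | Assign x e => (0 < reg x < nvar) && fits nvar e
  | Write a e => fits nvar a && fits nvar.+1 e
  | Seq c1 c2 => well_formed c1 && well_formed c2
  | If e c1 c2 => [&& fits nvar e, well_formed c1 & well_formed c2]
  | For x c => [&& 0 < reg x < nvar, reg x \notin assigned c & well_formed c]
  end.

Lemma vsize_unassigned c : well_formed c -> reg vsize \notin assigned c.
Proof.
elim: c => [|x e|a e|c1 IH1 c2 IH2|e c1 IH1 c2 IH2|x c IH] //=.
- by case/andP=> /andP[x_gt0 _] _; rewrite inE; lia.
- by case/andP=> /IH1 free1 /IH2 free2; rewrite mem_cat negb_or free1.
- by case/and3P=> _ /IH1 free1 /IH2 free2; rewrite mem_cat negb_or free1.
- by case/and3P=> /andP[x_gt0 _] _ /IH free; rewrite inE negb_or free; lia.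
Qed.

Fixpoint loop_depth (c : cmd) : nat :=
  match c with
  | Seq c1 c2 | If _ c1 c2 => maxn (loop_depth c1) (loop_depth c2)
  | For _ c => (loop_depth c).+1
  | _ => 0
  end.

Fixpoint compile_expr (d : nat) (e : expr) : seq instr :=
  match e with
  | Cst k => [:: IConst d k]
  | Var x => [:: IConst d 0; IAdd d d (reg x)]
  | Add a b => compile_expr d a ++ compile_expr d.+1 b ++ [:: IAdd d d d.+1]
  | Sub a b => compile_expr d a ++ compile_expr d.+1 b ++ [:: ISub d d d.+1]
  | Read a => compile_expr d a ++ [:: IConst d.+1 nreg; IAdd d d d.+1; ILoad d d]
  end.

Definition compile_test (e : expr) : seq instr := compile_expr nvar e.

Definition compile_assign (x : var) (e : expr) : seq instr :=
  compile_expr nvar e ++ [:: IConst (reg x) 0; IAdd (reg x) (reg x) nvar].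

Definition compile_write (a e : expr) : seq instr :=
  compile_expr nvar a ++ compile_expr nvar.+1 e ++
  [:: IConst nvar.+2 nreg; IAdd nvar nvar nvar.+2; IStore nvar nvar.+1].

Arguments compile_test : simpl never.
Arguments compile_assign : simpl never.
Arguments compile_write : simpl never.

Fixpoint compile (o : nat) (c : cmd) : seq instr :=
  match c with
  | Skip => [::]
  | Assign x e => compile_assign x e
  | Write a e => compile_write a e
  | Seq c1 c2 => let code1 := compile o c1 in code1 ++ compile (o + size code1) c2
  | If e c1 c2 =>
      let test := compile_test e in
      let o1 := (o + size test).+1 in
      let code1 := compile o1 c1 in
      let o2 := (o1 + size code1).+1 in
      let code2 := compile o2 c2 in
      test ++ IJz nvar o2 :: code1 ++ IJmp (o2 + size code2) :: code2
  | For x c =>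
      let test := compile_test (vsize - x)%E in
      let next := compile_assign x (x + 1)%E in
      let o1 := (o.+1 + size test).+1 in
      let code := compile (o1 + size next) c in
      IConst (reg x) 0 :: test ++
      IJz nvar (o1 + size next + size code).+1 :: next ++ code ++ [:: IJmp o.+1]
  end.

Definition represents (m : memory) (s : state) : Prop :=
  (forall r, r < nvar -> m r = s.1 r) /\ (forall a, m (nreg + a) = s.2 a).

Lemma straight_compile_expr d e : all straight (compile_expr d e).
Proof. by elim: e d => //= a IHa *; rewrite !all_cat ?IHa //= andbT. Qed.

Lemma straight_compile_assign x e : all straight (compile_assign x e).
Proof. by rewrite all_cat straight_compile_expr. Qed.

Lemma straight_compile_write a e : all straight (compile_write a e).
Proof. by rewrite !all_cat !straight_compile_expr. Qed.

Lemma represents_assign m s x k : reg x < nvar -> represents m s ->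
  represents (upd m (reg x) k) (assign s x k).
Proof.
move=> lt_x [rep_var rep_heap]; split=> [r lt_r|a] /=; first by rewrite /upd rep_var.
by rewrite upd_neq ?rep_heap //; rewrite /nvar /nreg in lt_x *; lia.
Qed.

Definition agree_outside (d : nat) (m m' : memory) : Prop :=
  forall r, (r < d) || (nreg <= r) -> m' r = m r.

Lemma represents_agree d m m' s : nvar <= d ->
  agree_outside d m m' -> represents m s -> represents m' s.
Proof.
move=> ge_d agree [rep_var rep_heap]; split=> [r lt_r|a]; rewrite agree.
- exact: rep_var.
- by rewrite (leq_trans lt_r).
- exact: rep_heap.
- by rewrite leq_addr orbT.
Qed.

Lemma fits_lt d e : fits d e -> d < nreg.
Proof.
elim: e d => [k|x|a IHa b IHb|a IHa b IHb|a IHa] d //= /andP[] //.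
- by move=> /IHa.
- by move=> /IHa.
- by move=> _ /ltnW.
Qed.

Definition computes (d : nat) (l : seq instr) (s : state) (k : nat) : Prop :=
  forall m, represents m s ->
    run_block l m d = k /\ agree_outside d m (run_block l m).

Lemma computes_represents d l s k m : nvar <= d ->
  computes d l s k -> represents m s -> represents (run_block l m) s.
Proof. by move=> ge_d comp rep; have [_ /represents_agree] := comp m rep; apply. Qed.

Lemma computes_pair d l1 l2 s k1 k2 m : nvar <= d -> d < nreg ->
  computes d l1 s k1 -> computes d.+1 l2 s k2 -> represents m s ->
  let m' := run_block (l1 ++ l2) m in
  [/\ m' d = k1, m' d.+1 = k2 & agree_outside d m m'].
Proof.
move=> ge_d lt_d comp1 comp2 rep; rewrite /= run_block_cat.
have [val1 frame1] := comp1 m rep.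
have [val2 frame2] := comp2 _ (computes_represents ge_d comp1 rep).
split=> // [|r lt_r]; first by rewrite frame2 // ltnSn.
by rewrite frame2 ?frame1 //; lia.
Qed.

Lemma computes_compile_expr d e s :
  nvar <= d -> fits d e -> computes d (compile_expr d e) s (eval s e).
Proof.
elim: e d => [k|x|a IHa b IHb|a IHa b IHb|a IHa] d ge_d fit m rep;
  have lt_d := fits_lt fit; move: fit => /=.
3-4: case/andP=> fit_a fit_b; rewrite catA run_block_cat;
  have [va vb frame] := computes_pair ge_d lt_d (IHa _ ge_d fit_a)
    (IHb _ (leqW ge_d) fit_b) rep;
  by split=> [|r lt_r] /=; [rewrite upd_eq ?va ?vb | rewrite upd_neq ?frame //; lia].
- by split=> [|r lt_r] /=; [rewrite upd_eq | rewrite upd_neq //; lia].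
- case/andP=> lt_x _; split=> [|r lt_r] /=; last by rewrite !upd_neq //; lia.
  by rewrite upd_eq // [upd _ _ _ d]upd_eq // upd_neq ?(proj1 rep) //; lia.
case/andP=> fit_a lt_dS; rewrite run_block_cat /=.
have [va frame] := IHa _ ge_d fit_a m rep; split=> [|r lt_r].
  have [_ rep_heap] := computes_represents ge_d (IHa _ ge_d fit_a) rep.
  rewrite /upd !eqxx (ltn_eqF (ltnSn d)) va -rep_heap [nreg + _]addnC.
  by rewrite !ifF //; lia.
by rewrite !upd_neq ?frame //; lia.
Qed.

Lemma run_compile_assign x e m s : reg x < nvar -> fits nvar e -> represents m s ->
  represents (run_block (compile_assign x e) m) (assign s x (eval s e)).
Proof.
move=> lt_x fit rep; rewrite /compile_assign run_block_cat.
have [val frame] := computes_compile_expr (leqnn nvar) fit rep.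
have [rep_var rep_heap] := rep.
split=> [r lt_r|a] /=; last by rewrite !upd_neq ?frame //; rewrite /nvar /nreg in lt_x *; lia.
have [->|/eqP neq_r] := eqVneq r (reg x); last by rewrite !upd_neq ?frame ?rep_var; lia.
by rewrite /upd !eqxx ifF ?val //; lia.
Qed.

Lemma run_compile_write a e m s : fits nvar a -> fits nvar.+1 e -> represents m s ->
  represents (run_block (compile_write a e) m)
             (s.1, upd s.2 (eval s a) (eval s e)).
Proof.
move=> fit_a fit_e rep; rewrite /compile_write catA run_block_cat.
have [va ve frame] := computes_pair (leqnn nvar) isT
  (computes_compile_expr (leqnn nvar) fit_a) (computes_compile_expr (leqnSn nvar) fit_e) rep.
have [rep_var rep_heap] := rep.
rewrite /=; set m1 := run_block _ _ in va ve frame *.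
set m2 := upd (upd m1 _ _) _ _.
have -> : m2 nvar = nreg + eval s a.
  by rewrite /m2 upd_eq // [upd _ _ _ nvar]upd_neq // upd_eq // va addnC.
have -> : m2 nvar.+1 = eval s e by rewrite /m2 !upd_neq.
have m2_frame : agree_outside nvar m m2.
  move=> r lt_r; rewrite /m2 !upd_neq ?frame //; rewrite /nvar /nreg in lt_r *; lia.
split=> [r lt_r|b] /=.
  by rewrite upd_neq ?m2_frame ?lt_r ?rep_var //; rewrite /nvar /nreg in lt_r *; lia.
rewrite /upd eqn_add2l; case: eqP => // _.
by rewrite m2_frame ?leq_addr ?orbT.
Qed.

Lemma reaches_test e p o o' l m s :
  fits nvar e -> represents m s ->
  code_at p o (compile_test e ++ IJz nvar o' :: l) ->
  let test_end := (o + size (compile_test e)).+1 in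
  exists2 m', reaches p (size (compile_test e)).+1 (o, m)
                (if eval s e == 0 then o' else test_end, m') & represents m' s.
Proof.
move=> fit rep code.
have comp := computes_compile_expr (s := s) (leqnn nvar) fit.
have [val _] := comp m rep.
exists (run_block (compile_test e) m).
  2: exact: computes_represents comp rep.
rewrite -addn1; apply: reaches_trans.
  exact: reaches_block (straight_compile_expr _ _) (code_at_catl code).
by apply: reaches_step; rewrite (code_at_step _ (code_at_catr code)) val.
Qed.

Definition loop_state (x : var) (c : cmd) (s : state) (k : nat) : state :=
  iteri k (fun j s' => exec c (assign s' x j.+1)) (assign s x 0).

Lemma loop_state_index x c s k : reg x \notin assigned c ->
  (loop_state x c s k).1 (reg x) = k.
Proof.
move=> x_c; case: k => [|k]; first by rewrite /= eqxx.
by rewrite /= exec_unassigned //= eqxx.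
Qed.

Lemma loop_state_size x c s k : well_formed (For x c) ->
  (loop_state x c s k).1 (reg vsize) = s.1 (reg vsize).
Proof.
case/and3P=> /andP[x_gt0 _] _ /vsize_unassigned size_c.
elim: k => [|k IHk] /=; first by rewrite ltn_eqF.
by rewrite exec_unassigned //= ltn_eqF.
Qed.

Definition compiles (c : cmd) : Prop := forall p o m s,
  code_at p o (compile o c) -> well_formed c -> represents m s ->
  exists2 m',
    reaches p (size (compile o c) * (s.1 (reg vsize)).+1 ^ loop_depth c)
      (o, m) (o + size (compile o c), m') &
    represents m' (exec c s).

Lemma compiles_straight c l : (forall o, compile o c = l) -> all straight l ->
  (forall m s, well_formed c -> represents m s ->
     represents (run_block l m) (exec c s)) ->
  compiles c.
Proof.
move=> compE straight_l repl p o m s; rewrite compE => code wf rep.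
exists (run_block l m); last exact: repl.
by apply: reaches_leq (reaches_block m straight_l code); rewrite leq_pmulr // expn_gt0.
Qed.

Lemma compiles_seq c1 c2 : compiles c1 -> compiles c2 -> compiles (Seq c1 c2).
Proof.
move=> ok1 ok2 p o m s /= code /andP[wf1 wf2] rep.
have [m1 run1 rep1] := ok1 _ _ _ _ (code_at_catl code) wf1 rep.
have [m2 run2 rep2] := ok2 _ _ _ _ (code_at_catr code) wf2 rep1.
exists m2 => //; rewrite size_cat addnA; apply: reaches_leq (reaches_trans run1 run2).
rewrite exec_unassigned ?vsize_unassigned // mulnDl.
by rewrite leq_add // leq_mul // leq_pexp2l // ?leq_maxl ?leq_maxr.
Qed.

Lemma compiles_if e c1 c2 : compiles c1 -> compiles c2 -> compiles (If e c1 c2).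
Proof.
move=> ok1 ok2 p o m s /= code /and3P[fit wf1 wf2] rep.
set test := compile_test _ in code *; set o1 := (o + size test).+1 in code *.
set code1 := compile o1 c1 in code *; set o2 := (o1 + size code1).+1 in code *.
set code2 := compile o2 c2 in code *; set n := s.1 0.
have [m0 run0 rep0] := reaches_test fit rep code.
have /code_at_behead after_test := code_at_catr code.
have at1 : code_at p o1 code1 by apply: code_at_catl after_test.
have at_jmp := code_at_catr after_test; have at2 := code_at_behead at_jmp.
have -> : o + size (test ++ IJz nvar o2 :: code1 ++ IJmp (o2 + size code2) :: code2) =
    o2 + size code2 by rewrite size_cat /= size_cat /= /o2 /o1; lia.
set d := maxn _ _.
have time_c1 : n.+1 ^ loop_depth c1 <= n.+1 ^ d by rewrite leq_pexp2l ?leq_maxl.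
have time_c2 : n.+1 ^ loop_depth c2 <= n.+1 ^ d by rewrite leq_pexp2l ?leq_maxr.
have time_gt0 : 0 < n.+1 ^ d by rewrite expn_gt0.
rewrite size_cat /= size_cat /=; case: ifP => [/eqP eval0|eval_neq0].
  rewrite eval0 eqxx in run0.
  have [m2 run2 rep2] := ok2 _ _ _ _ at2 wf2 rep0; exists m2 => //.
  apply: reaches_leq (reaches_trans run0 run2).
  apply: leq_trans (leq_add (leq_pmulr _ time_gt0) (leq_mul (leqnn _) time_c2)) _.
  by rewrite -mulnDl leq_mul2r -/test -/code2; lia.
rewrite eval_neq0 in run0.
have [m1 run1 rep1] := ok1 _ _ _ _ at1 wf1 rep0; exists m1 => //.
apply: reaches_leq (reaches_trans run0 (reaches_trans run1 (reaches_step _))).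
  2: by rewrite (code_at_step _ at_jmp).
apply: leq_trans (leq_add (leq_pmulr _ time_gt0)
  (leq_add (leq_mul (leqnn _) time_c1) (leq_pmulr 1 time_gt0))) _.
by rewrite -!mulnDl leq_mul2r -/test -/code1; lia.
Qed.

Lemma reaches_iteration x c p o m s k : compiles c -> well_formed (For x c) ->
  code_at p o (compile o (For x c)) ->
  k < s.1 (reg vsize) -> represents m (loop_state x c s k) ->
  exists2 m',
    reaches p (size (compile o (For x c)) * (s.1 (reg vsize)).+1 ^ loop_depth c)
      (o.+1, m) (o.+1, m') &
    represents m' (loop_state x c s k.+1).
Proof.
move=> ok wf; rewrite /compile -/compile.
have /and3P[/andP[x_gt0 lt_x] x_c wf_c] := wf.
set test := compile_test _; set next := compile_assign _ _.
set o1 := (o.+1 + size test).+1; set code := compile _ c.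
move=> /code_at_behead at_test lt_k rep.
have fit : fits nvar (vsize - x)%E by rewrite /= lt_x.
have [m0 run0 rep0] := reaches_test fit rep at_test.
rewrite [eval _ _]/= loop_state_index // loop_state_size // subn_eq0 leqNgt lt_k in run0.
have at_next := code_at_behead (code_at_catr at_test).
have run1 := reaches_block m0 (straight_compile_assign _ _) (code_at_catl at_next).
have fit_next : fits nvar (x + 1)%E by rewrite /= lt_x.
have rep1 := run_compile_assign lt_x fit_next rep0.
rewrite [eval _ _]/= loop_state_index // addn1 in rep1.
have at_code := code_at_catr at_next.
have [m2 run2 rep2] := ok _ _ _ _ (code_at_catl at_code) wf_c rep1.
exists m2 => //; have at_jmp := code_at_catr at_code.
apply: reaches_leq (reaches_trans run0 (reaches_trans run1
  (reaches_trans run2 (reaches_step _)))); last by rewrite (code_at_step _ at_jmp).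
have -> : (assign (loop_state x c s k) x k.+1).1 (reg vsize) = s.1 (reg vsize).
  by rewrite /= ltn_eqF ?loop_state_size.
have time_gt0 : 0 < (s.1 (reg vsize)).+1 ^ loop_depth c by rewrite expn_gt0.
apply: leq_trans (leq_add (leq_pmulr _ time_gt0) (leq_add (leq_pmulr _ time_gt0)
  (leq_add (leqnn _) (leq_pmulr 1 time_gt0)))) _.
by rewrite -!mulnDl leq_mul2r size_cat /= !size_cat /= -/code -/test -/next; lia.
Qed.

Lemma compiles_for x c : compiles c -> compiles (For x c).
Proof.
move=> ok p o m s code wf rep; set n := s.1 (reg vsize).
set len := size _; set body_time := len * n.+1 ^ loop_depth c.
have /and3P[/andP[_ lt_x] x_c _] := wf.
have [m0 run0 rep0] : exists2 m0, reaches p 1 (o, m) (o.+1, m0) &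
    represents m0 (loop_state x c s 0).
  exists (upd m (reg x) 0); first by apply: reaches_step; rewrite (code_at_step _ code).
  exact: represents_assign.
have [m1 run1 rep1] : exists2 m1, reaches p (n * body_time) (o.+1, m0) (o.+1, m1) &
    represents m1 (loop_state x c s n).
  move: (leqnn n); move: {-2}n => k; elim: k => [|k IHk] lt_k.
    by exists m0 => //; apply: reaches_refl.
  have [m1 run1 rep1] := IHk (ltnW lt_k).
  have [m2 run2 rep2] := reaches_iteration ok wf code lt_k rep1.
  by exists m2 => //; rewrite mulSnr; apply: reaches_trans run1 run2.
have fit : fits nvar (vsize - x)%E by rewrite /= lt_x.
have [m2 run2 rep2] := reaches_test fit rep1 (code_at_behead code).
rewrite [eval _ _]/= loop_state_index // loop_state_size // subnn eqxx in run2.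
exists m2 => //; have lenE : len = size (compile o (For x c)) by [].
move: run2; rewrite /compile -/compile in lenE *.
set test := compile_test _ in lenE *; set next := compile_assign _ _ in lenE *.
clearbody test next.
rewrite /= size_cat /= !size_cat /= in lenE.
set o' := (_ + size next + _).+1 => run2.
have -> : o + len = o' by rewrite lenE /o'; lia.
apply: reaches_leq (reaches_trans run0 (reaches_trans run1 run2)).
have len_le : len <= body_time by rewrite leq_pmulr // expn_gt0.
by rewrite [loop_depth _]/= expnS mulnCA -/body_time mulSnr; lia.
Qed.

Lemma compile_correct c : compiles c.
Proof.
elim: c => [|x e|a e|c1 IH1 c2 IH2|e c1 IH1 c2 IH2|x c IH].
- exact: (compiles_straight (l := [::])).
- apply: compiles_straight (straight_compile_assign x e) _ => // m s /= /andP[/andP[_]].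
  exact: run_compile_assign.
- apply: compiles_straight (straight_compile_write a e) _ => // m s /= /andP[].
  exact: run_compile_write.
- exact: compiles_seq.
- exact: compiles_if.
- exact: compiles_for.
Qed.

(** * The program *)

Notation vstride := (VarId 1).
Notation vbase := (VarId 2).
Notation vrow := (VarId 3).
Notation vcol := (VarId 4).
Notation vbest := (VarId 5).
Notation vcount := (VarId 6).
Notation vround := (VarId 7).

(* With [b] and [L] the values of [vbase] and [vstride], the heap is laid out as
   follows, where [row i = (4 + i) * L]:
     [b + i]        the value in position [i], for [0 < i <= n];
     [L + x]        the position of the value [x], for [0 < x <= n];
     [2 * L + i]    the address [row i], for [i <= n];
     [3 * L + j]    the [j]-th cell of the output;
     [row i + v]    the length of [best i v], for [i, v <= n]. *)
Definition value_cell (i : expr) : expr := vbase + i.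
Definition position_cell (x : expr) : expr := vstride + x.
Definition row_cell (i : expr) : expr := vstride + vstride + i.
Definition output_cell (j : expr) : expr := vstride + vstride + vstride + j.
Definition table_cell (i v : expr) : expr := Read (row_cell i) + v.

Definition Max (a b : expr) : expr := a + (b - a).

Lemma eval_Max s a b : eval s (Max a b) = maxn (eval s a) (eval s b).
Proof. by rewrite maxnE. Qed.

(* The input cells below [nreg] have already been moved to their places. *)
Definition copy_input : cmd :=
  For vrow (When (vrow - nreg.-1)%E (Write (value_cell vrow) (Read (vrow - nreg)%E))).

Definition set_stride : cmd := Assign vstride (vbase + vsize + 1).

Definition index_arrays : cmd :=
  Write (row_cell 0) (vstride + vstride + vstride + vstride)%E ;;
  For vrow
    (Write (position_cell (Read (value_cell vrow))) vrow ;;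
     Write (row_cell vrow) (Read (row_cell (vrow - 1)) + vstride)%E).

Definition clear_boundary : cmd :=
  Write (table_cell 0 0) 0 ;;
  For vrow (Write (table_cell vrow 0) 0 ;; Write (table_cell 0 vrow) 0).

Definition fill_cell : cmd :=
  Assign vbest (Max (Read (table_cell (vrow - 1) vcol)) (Read (table_cell vrow (vcol - 1)))) ;;
  When (vrow - Read (position_cell vcol))%E
    (When (vcol - Read (value_cell vrow))%E
      (Assign vbest
        (Max vbest (Read (table_cell (Read (position_cell vcol) - 1)
                                    (Read (value_cell vrow) - 1)) + 1)))) ;;
  Write (table_cell vrow vcol) vbest.

Definition fill_table : cmd := For vrow (For vcol fill_cell).

Definition emit_edge : cmd :=
  Write (output_cell (vcount + vcount + 1)) (Read (value_cell vrow)) ;;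
  Write (output_cell (vcount + vcount + 2)) vcol ;;
  Assign vcount (vcount + 1) ;;
  Assign vbest (Read (value_cell vrow) - 1) ;;
  Assign vrow (Read (position_cell vcol) - 1) ;;
  Assign vcol vbest.

Definition trace_step : cmd :=
  When (Read (table_cell vrow vcol))
    (If (Read (table_cell vrow vcol) - Read (table_cell (vrow - 1) vcol))
      (If (Read (table_cell vrow vcol) - Read (table_cell vrow (vcol - 1)))
        emit_edge
        (Assign vcol (vcol - 1)))
      (Assign vrow (vrow - 1))).

(* Each step decreases the sum of [vrow] and [vcol], which is [2 * n] at first. *)
Definition trace : cmd :=
  Assign vrow vsize ;; Assign vcol vsize ;; Assign vcount 0 ;;
  For vround (trace_step ;; trace_step) ;;
  Write (output_cell 0) vcount.

(* The output cells below [nreg] have to wait until the registers are free. *)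
Definition copy_output : cmd :=
  For vrow (When (vrow - nreg.-1)%E (Write (vrow - nreg)%E (Read (output_cell vrow)))).

Definition matching_cmd : cmd :=
  copy_input ;; set_stride ;; index_arrays ;; clear_boundary ;;
  fill_table ;; trace ;; copy_output.

Lemma well_formed_matching_cmd : well_formed matching_cmd.
Proof. by []. Qed.

Lemma loop_depth_matching_cmd : loop_depth matching_cmd = 2.
Proof. by []. Qed.

Arguments exec : simpl never.
Arguments eval : simpl never.

Section Correctness.
Variables (n b : nat) (value pos : nat -> nat).
Hypotheses (b_gt : n < b) (valueK : cancel_upto n value pos) (posK : cancel_upto n pos value).

Local Notation best := (best value pos).

Let stride := b + n.+1.
Let strideE : stride = b + n.+1 := erefl.
Let nregE : nreg = 16 := erefl.

Definition row_address (i : nat) : nat := (4 + i) * stride.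

Lemma row_addressS i : row_address i.+1 = row_address i + stride.
Proof. by rewrite /row_address addnS mulSn addnC. Qed.

Lemma row_address_ge i : 4 * stride <= row_address i.
Proof. by rewrite leq_mul2r leq_addr orbT. Qed.

Lemma row_address_inj i v i' v' : v <= n -> v' <= n ->
  row_address i + v = row_address i' + v' -> i = i' /\ v = v'.
Proof.
move=> le_v le_v' /(congr1 (fun a => (a %/ stride, a %% stride))).
have [lt_v lt_v'] : v < stride /\ v' < stride by rewrite /stride; lia.
rewrite !divnMDl ?modnMDl ?divn_small ?modn_small //; try lia.
by case; lia.
Qed.

Definition pointers_ready (s : state) : Prop :=
  [/\ s.1 (reg vsize) = n, s.1 (reg vbase) = b & s.1 (reg vstride) = stride].

Definition values_ready (h : memory) : Prop := forall i, 0 < i <= n -> h (b + i) = value i.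

Definition arrays_ready (h : memory) : Prop :=
  [/\ values_ready h,
      forall x, 0 < x <= n -> h (stride + x) = pos x &
      forall i, i <= n -> h (2 * stride + i) = row_address i].

Definition layout (s : state) : Prop := pointers_ready s /\ arrays_ready s.2.

Lemma layout_assign s x k : 2 < reg x -> layout s -> layout (assign s x k).
Proof. by move=> gt_x [[? ? ?] ?]; split=> //; split; rewrite /= ltn_eqF //; lia. Qed.

Lemma layout_write s a k : 3 * stride <= a -> layout s -> layout (s.1, upd s.2 a k).
Proof.
move=> ge_a [ptrs [vals poss rows]]; split=> //.
by split=> j lt_j /=; rewrite upd_neq ?(vals, poss, rows) //; lia.
Qed.

Lemma eval_value s e : layout s -> 0 < eval s e <= n ->
  eval s (Read (value_cell e)) = value (eval s e).
Proof. by case=> -[_ eq_b _] [vals _ _] lt_e; rewrite !evalE eq_b vals. Qed.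

Lemma eval_position s e : layout s -> 0 < eval s e <= n ->
  eval s (Read (position_cell e)) = pos (eval s e).
Proof. by case=> -[_ _ eq_stride] [_ poss _] lt_e; rewrite !evalE eq_stride poss. Qed.

Lemma eval_table s e1 e2 : layout s -> eval s e1 <= n ->
  eval s (table_cell e1 e2) = row_address (eval s e1) + eval s e2.
Proof.
by case=> -[_ _ eq_stride] [_ _ rows] le_e; rewrite !evalE eq_stride addnn -mul2n rows.
Qed.

Lemma exec_write_table s e1 e2 e : layout s -> eval s e1 <= n ->
  exec (Write (table_cell e1 e2) e) s =
    (s.1, upd s.2 (row_address (eval s e1) + eval s e2) (eval s e)).
Proof. by move=> lay le_e1; rewrite execE eval_table. Qed.

Lemma layout_write_table s i v k : layout s ->
  layout (s.1, upd s.2 (row_address i + v) k).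
Proof. by have := row_address_ge i => ge_i; apply: layout_write; lia. Qed.

Lemma eval_output s e : layout s -> eval s (output_cell e) = 3 * stride + eval s e.
Proof. by case=> -[_ _ eq_stride] _; rewrite !evalE eq_stride; lia. Qed.

Lemma exec_copy_input s :
  s.1 (reg vsize) = n -> s.1 (reg vbase) = b ->
  (forall i, 0 < i <= n -> i < nreg -> s.2 (b + i) = value i) ->
  (forall i, nreg <= i <= n -> s.2 (i - nreg) = value i) ->
  values_ready (exec copy_input s).2.
Proof.
move=> sizeE baseE low high; rewrite /copy_input.
pose I k (s' : state) := [/\ s'.1 (reg vbase) = b,
  forall i, nreg <= i <= n -> s'.2 (i - nreg) = value i &
  forall i, 0 < i <= n -> i < maxn nreg k.+1 -> s'.2 (b + i) = value i].
have [] : I n (exec copy_input s).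
  apply: (exec_For sizeE) => [|k s' lt_k [baseE' high' low']].
    by split=> //= i lt_i; rewrite maxnE => ?; apply: low.
  rewrite !execE !evalE /= baseE'; case: ifP => gt_k; split=> //=.
  - by move=> i lt_i; rewrite upd_neq ?high' //; lia.
  - move=> i lt_i lt_iS; have [->|neq_i] := eqVneq i k.+1.
      by rewrite upd_eq ?high' //; lia.
    by rewrite upd_neq ?low' //; lia.
  - by move=> i lt_i lt_iS; apply: low' => //; lia.
by move=> _ _ done i lt_i; apply: done => //; lia.
Qed.

Lemma exec_index_arrays s : pointers_ready s -> values_ready s.2 ->
  layout (exec index_arrays s).
Proof.
move=> ptrs vals; have [size_s base_s stride_s] := ptrs.
pose I k (s' : state) := [/\ pointers_ready s', values_ready s'.2,
  forall i, 0 < i <= k -> s'.2 (stride + value i) = i &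
  forall i, i <= k -> s'.2 (2 * stride + i) = row_address i].
have [] : I n (exec index_arrays s).
  rewrite /index_arrays !execE !evalE /= stride_s.
  apply: exec_For => //= [|k s' lt_k [ptrs' vals' poss rows]].
    split=> //= [i lt_i|i lt_i|[|i] //= _]; first by rewrite upd_neq ?vals //; lia.
      by lia.
    by rewrite upd_eq; rewrite /row_address; lia.
  have [_ base_s' stride_s'] := ptrs'.
  have [lo_w pos_w] := @valueK k.+1 lt_k.
  rewrite !execE !evalE /= base_s' stride_s' vals' // upd_neq; last by lia.
  have -> : stride + stride + (k.+1 - 1) = 2 * stride + k by lia.
  rewrite rows // -row_addressS; split=> //= i lt_i.
  - by rewrite !upd_neq ?vals' //; lia.
  - have [->|neq_i] := eqVneq i k.+1; first by rewrite upd_neq ?upd_eq //; lia.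
    have [lo_i pos_i] := @valueK i (ltac:(lia)).
    have neq_w : value i <> value k.+1 by move=> eq_w; rewrite eq_w pos_w in pos_i; lia.
    by rewrite !upd_neq ?poss //; lia.
  - have [->|neq_i] := eqVneq i k.+1; first by rewrite upd_eq //; lia.
    by rewrite !upd_neq ?rows //; lia.
move=> ptrs' vals' poss rows; split=> //; split=> // x lt_x.
by have [lo_p val_p] := posK lt_x; rewrite -{1}val_p poss.
Qed.

Definition filled (i v : nat) (h : memory) : Prop := forall i' v', i' <= n -> v' <= n ->
  [|| i' < i, (i' == i) && (v' <= v) | v' == 0] ->
  h (row_address i' + v') = size (best i' v').

Lemma filled_upd i v h : i < n -> v < n -> filled i.+1 v h ->
  filled i.+1 v.+1 (upd h (row_address i.+1 + v.+1) (size (best i.+1 v.+1))).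
Proof.
move=> lt_i lt_v fill i' v' le_i le_v done.
have [/andP[/eqP-> /eqP->]|neq] := boolP ((i' == i.+1) && (v' == v.+1)).
  by rewrite upd_eq.
rewrite upd_neq; first by apply: fill => //; lia.
by move=> /row_address_inj []; lia.
Qed.

Lemma exec_clear_boundary s : layout s ->
  let s' := exec clear_boundary s in layout s' /\ filled 0 n s'.2.
Proof.
move=> lay.
pose I k (s' : state) := layout s' /\
  forall i, i <= k -> s'.2 (row_address 0 + i) = 0 /\ s'.2 (row_address i) = 0.
have [] : I n (exec clear_boundary s).
  rewrite /clear_boundary execE exec_write_table // !evalE addn0.
  apply: exec_For => [||k s' lt_k [lay' zeros]]; first by have [[]] := lay.
    split; last by move=> [|i] //= _; rewrite addn0 upd_eq.
    by rewrite -[row_address 0]addn0; apply/layout_assign/layout_write_table.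
  have lay0 : layout (assign s' vrow k.+1) by apply: layout_assign.
  rewrite execE (exec_write_table (e1 := vrow) _ _ lay0 lt_k) !evalE /=; set s1 := (_, _).
  have lay1 : layout s1 by apply: (layout_write_table _ _ _ lay0).
  rewrite exec_write_table // !evalE /=; split; first exact: (layout_write_table _ _ _ lay1).
  move=> i le_i /=; rewrite addn0 /upd; have [->|neq_i] := eqVneq i k.+1.
    by split; do !case: eqP.
  by have [zero_row zero_col] := zeros i (ltac:(lia)); split; do !case: eqP.
move=> lay' zeros; split=> // i v le_i le_v /= /orP[/andP[/eqP-> _]|/eqP->].
  by rewrite best_row0; have [] := zeros v.
by rewrite best_col0 addn0; have [] := zeros i.
Qed.

Lemma eval_filled i v s e1 e2 : layout s -> filled i v s.2 ->
  eval s e1 <= n -> eval s e2 <= n ->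
  [|| eval s e1 < i, (eval s e1 == i) && (eval s e2 <= v) | eval s e2 == 0] ->
  eval s (Read (table_cell e1 e2)) = size (best (eval s e1) (eval s e2)).
Proof.
move=> lay fill le_e1 le_e2 done.
by rewrite eval_Read eval_table ?fill.
Qed.

Lemma exec_fill_cell i v s : i < n -> v < n -> layout s -> filled i.+1 v s.2 ->
  s.1 (reg vrow) = i.+1 -> s.1 (reg vcol) = v.+1 ->
  let s' := exec fill_cell s in layout s' /\ filled i.+1 v.+1 s'.2.
Proof.
move=> lt_i lt_v lay fill rowE colE.
have [lo_w pos_w] := @valueK i.+1 lt_i; have [lo_p val_p] := @posK v.+1 lt_v.
pose neighbour := maxn (size (best i v.+1)) (size (best i.+1 v)).
have lay' k : layout (assign s vbest k) by apply: layout_assign.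
have valE k : eval (assign s vbest k) (Read (value_cell vrow)) = value i.+1.
  by rewrite eval_value // evalE /= rowE.
have posE k : eval (assign s vbest k) (Read (position_cell vcol)) = pos v.+1.
  by rewrite eval_position // evalE /= colE.
rewrite /fill_cell execE.
have -> : exec (Assign vbest (Max (Read (table_cell (vrow - 1) vcol))
    (Read (table_cell vrow (vcol - 1)))))%E s = assign s vbest neighbour.
  by rewrite execE eval_Max !(eval_filled lay fill) !evalE /= ?rowE ?colE ?subn1 //=; lia.
set s1 := assign s vbest neighbour; rewrite execE; set s2 := exec _ s1.
have [lay2 heap2 [row2 col2 best2]] : [/\ layout s2, s2.2 = s.2 &
    [/\ s2.1 (reg vrow) = i.+1, s2.1 (reg vcol) = v.+1 &
        s2.1 (reg vbest) = size (best i.+1 v.+1)]].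
  rewrite /s2 bestSS execE eval_Sub posE evalE /= rowE subn_gt0.
  case: (ltnP (pos v.+1)) => [lt_p|_] /=; last by rewrite size_longest.
  rewrite execE eval_Sub valE evalE /= colE subn_gt0.
  case: (ltnP (value i.+1)) => [lt_w|_] /=; last by rewrite size_longest.
  rewrite execE; split=> //; split=> //=.
  have rowE' : eval s1 (Read (position_cell vcol) - 1)%E = (pos v.+1).-1.
    by rewrite eval_Sub posE evalE subn1.
  have colE' : eval s1 (Read (value_cell vrow) - 1)%E = (value i.+1).-1.
    by rewrite eval_Sub valE evalE subn1.
  rewrite eval_Max eval_Add (eval_filled (s := s1) (lay' _) fill) ?rowE' ?colE'; try lia.
  by rewrite !evalE /= !size_longest addn1.
rewrite exec_write_table ?evalE ?row2 ?col2 ?best2 //.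
by split; [apply: (layout_write_table _ _ _ lay2) | rewrite /= heap2; apply: filled_upd].
Qed.

Lemma exec_fill_row i s : i < n -> layout s -> filled i n s.2 -> s.1 (reg vrow) = i.+1 ->
  let s' := exec (For vcol fill_cell) s in layout s' /\ filled i.+1 n s'.2.
Proof.
move=> lt_i lay fill rowE.
pose I v (s' : state) := [/\ layout s', filled i.+1 v s'.2 & s'.1 (reg vrow) = i.+1].
suff [] : I n (exec (For vcol fill_cell) s) by [].
apply: exec_For => [||v s' lt_v [lay' fill' rowE']]; first by have [[]] := lay.
  by split=> // i' v' le_i le_v done; apply: fill; lia.
have [] := @exec_fill_cell i v (assign s' vcol v.+1) lt_i lt_v lay' fill' rowE' erefl.
by move=> lay1 fill1; split; rewrite ?exec_unassigned.
Qed.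

Lemma exec_fill_table s : layout s -> filled 0 n s.2 ->
  let s' := exec fill_table s in layout s' /\ filled n n s'.2.
Proof.
move=> lay fill; apply: (exec_For (I := fun i s' => layout s' /\ filled i n s'.2)).
- by have [[]] := lay.
- by [].
by move=> i s' lt_i [lay' fill']; apply: exec_fill_row.
Qed.

Lemma exec_write_output s e1 e2 : layout s -> filled n n s.2 -> eval s e1 <= n ->
  let s' := exec (Write (output_cell e1) e2) s in
  [/\ s' = (s.1, upd s.2 (3 * stride + eval s e1) (eval s e2)), layout s' &
      filled n n s'.2].
Proof.
move=> lay fill le_e1; rewrite /= execE eval_output //; split=> //.
  by apply: layout_write lay; lia.
move=> i v le_i le_v done; have ge_i := row_address_ge i.
by rewrite /= upd_neq ?fill //; lia.
Qed.

Definition written (h : memory) (items : seq nat) : Prop :=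
  forall j, j < size items -> h (3 * stride + j.+1) = nth 0 items j.

Lemma written_rcons h items x : written h items ->
  written (upd h (3 * stride + (size items).+1) x) (rcons items x).
Proof.
move=> wr j; rewrite size_rcons nth_rcons => lt_j.
have [lt_js|ge_js] := ltnP j (size items); first by rewrite upd_neq ?wr //; lia.
have -> : j = size items by lia.
by rewrite eqxx upd_eq.
Qed.

Lemma exec_emit_edge i v out s : i < n -> v < n -> (size out).+1.*2 <= n ->
  layout s -> filled n n s.2 -> written s.2 (endpoints out) ->
  s.1 (reg vrow) = i.+1 -> s.1 (reg vcol) = v.+1 -> s.1 (reg vcount) = size out ->
  let s' := exec emit_edge s in
  [/\ layout s', filled n n s'.2,
      written s'.2 (endpoints (rcons out (value i.+1, v.+1))) &
      [/\ s'.1 (reg vrow) = (pos v.+1).-1, s'.1 (reg vcol) = (value i.+1).-1 &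
          s'.1 (reg vcount) = (size out).+1]].
Proof.
move=> lt_i lt_v lt_out lay fill wr rowE colE countE.
have size_out := size_endpoints out.
have cell1 : eval s (vcount + vcount + 1)%E = (size (endpoints out)).+1.
  by rewrite !evalE countE; lia.
have [|s1E lay1 fill1] := exec_write_output (e1 := (vcount + vcount + 1)%E)
  (Read (value_cell vrow)) lay fill; first by rewrite cell1; lia.
have val1 : eval s (Read (value_cell vrow)) = value i.+1.
  by rewrite eval_value // evalE rowE.
rewrite /emit_edge execE; rewrite s1E cell1 val1 in lay1 fill1 *.
set s1 := (_, _) in lay1 fill1 *.
have cell2 : eval s1 (vcount + vcount + 2)%E = (size (endpoints out)).+2.
  by rewrite !evalE /= countE; lia.
have [|s2E lay2 fill2] := exec_write_output (e1 := (vcount + vcount + 2)%E)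
  vcol lay1 fill1; first by rewrite cell2; lia.
have val2 : eval s1 vcol = v.+1 by [].
rewrite execE; rewrite s2E cell2 val2 in lay2 fill2 *.
set s2 := (_, _) in lay2 fill2 *.
rewrite !execE; split; [exact: lay2 | exact: fill2 | |].
  rewrite endpoints_rcons.
  have := written_rcons (x := v.+1) (written_rcons (x := value i.+1) wr).
  by rewrite size_rcons.
split.
- by rewrite /= eval_Sub eval_position ?evalE /= ?colE ?subn1.
- by rewrite /= evalE /= eval_Sub eval_value ?evalE /= ?rowE ?subn1.
- by rewrite /= !evalE /= countE addn1.
Qed.

Definition tracing (t : nat) (s : state) : Prop := exists i v out,
  [/\ layout s, filled n n s.2, written s.2 (endpoints out),
      [/\ s.1 (reg vrow) = i, s.1 (reg vcol) = v & s.1 (reg vcount) = size out] &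
      [/\ i <= n, v <= n, best i v = [::] \/ i + v + t <= n.*2 &
          out ++ best i v = best n n]].

Lemma exec_trace_step t s : tracing t s -> tracing t.+1 (exec trace_step s).
Proof.
move=> [i [v [out [lay fill wr [rowE colE countE] [le_i le_v left_t eq_out]]]]].
have entry e1 e2 i' v' : eval s e1 = i' -> eval s e2 = v' -> i' <= n -> v' <= n ->
    eval s (Read (table_cell e1 e2)) = size (best i' v').
  by move=> <- <- le_i' le_v'; rewrite (eval_filled lay fill) //; lia.
rewrite /trace_step execE (entry _ _ i v) //.
case: posnP => [/size0nil best0|best_gt0].
  by exists i, v, out; do !split=> //; left.
case: i best_gt0 le_i left_t eq_out rowE => [|i]; first by rewrite best_row0.
case: v le_v colE => [|v]; first by rewrite best_col0.
move=> lt_v colE best_gt0 lt_i left_t eq_out rowE.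
have {}left_t : i.+1 + v.+1 + t <= n.*2.
  by case: left_t best_gt0 => // ->.
rewrite execE eval_Sub (entry _ _ i.+1 v.+1) //.
rewrite (entry _ _ i v.+1) ?evalE ?rowE ?subn1 //; try lia.
rewrite subn_gt0; have /= := best_traceback value pos i v; case: leqP => [_ bestE|_].
  exists i, v.+1, out; rewrite execE !evalE /= rowE subn1 -bestE.
  by do !split=> //; [lia | right; lia].
rewrite execE eval_Sub (entry _ _ i.+1 v.+1) //.
rewrite (entry _ _ i.+1 v) ?evalE ?colE ?subn1 //; try lia.
rewrite subn_gt0; case: leqP => [_ bestE|_ bestE].
  exists i.+1, v, out; rewrite execE !evalE /= colE subn1 -bestE.
  by do !split=> //; [lia | right; lia].
have := best_chain valueK posK lt_i lt_v.
rewrite bestE /= => /and5P[lt_w _ lt_p le_w _].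
have lt_out : (size out).+1.*2 <= n.
  have := chain_size (best_chain valueK posK (leqnn n) (leqnn n)).
  by rewrite -eq_out bestE size_cat /=; lia.
have [lay' fill' wr' regs] := exec_emit_edge lt_i lt_v lt_out lay fill wr rowE colE countE.
exists (pos v.+1).-1, (value i.+1).-1, (rcons out (value i.+1, v.+1)).
rewrite size_rcons cat_rcons -bestE; split=> //.
by split=> //; [lia | lia | right; lia].
Qed.

Local Notation output := (encoding (best n n)).

Lemma exec_trace s : layout s -> filled n n s.2 ->
  let s' := exec trace s in
  pointers_ready s' /\
  forall j, j < size output -> s'.2 (3 * stride + j) = nth 0 output j.
Proof.
move=> lay fill; rewrite /trace !execE.
set s0 := assign _ vcount _.
have [[size_s _ _] _] := lay; have size_s0 : s0.1 (reg vsize) = n by [].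
have [i [v [out [lay' fill' wr' [_ _ countE] [_ _ left_n eq_out]]]]] :
  tracing n.*2 (exec (For vround (trace_step ;; trace_step)) s0).
  apply: (exec_For (I := fun k => tracing k.*2) size_s0) => [|k s' lt_k inv].
    exists n, n, [::]; rewrite /s0 !evalE /= size_s.
    by do !split=> //; right; lia.
  by rewrite execE doubleS; do 2!apply: exec_trace_step.
have best0 : best i v = [::].
  case: left_n => // le_n; have -> : i = 0 by lia.
  exact: best_row0.
set s1 := exec _ s0 in lay' fill' wr' countE *.
rewrite best0 cats0 in eq_out; rewrite eq_out in wr' countE.
rewrite eval_output // !evalE addn0; split; first by case: lay'.
move=> [|j] lt_j /=; first by rewrite upd_eq ?addn0.
by rewrite upd_neq ?wr' //; lia.
Qed.

Lemma exec_copy_output s : pointers_ready s ->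
  let s' := exec copy_output s in
  [/\ s'.1 (reg vstride) = stride,
      forall j, j <= n -> s'.2 (3 * stride + j) = s.2 (3 * stride + j) &
      forall j, nreg <= j <= n -> s'.2 (j - nreg) = s.2 (3 * stride + j)].
Proof.
case=> sizeE _ strideE' /=.
pose I k (s' : state) := [/\ s'.1 (reg vstride) = stride,
  forall j, j <= n -> s'.2 (3 * stride + j) = s.2 (3 * stride + j) &
  forall j, nreg <= j <= k -> s'.2 (j - nreg) = s.2 (3 * stride + j)].
suff : I n (exec copy_output s) by [].
apply: (exec_For sizeE) => [|k s' lt_k [stride_s' kept copied]]; first by split=> //=; lia.
rewrite !execE !evalE /= stride_s'; case: ifP => gt_k; split=> //=.
- by move=> j le_j; rewrite upd_neq ?kept //; lia.
- move=> j le_j; have [->|neq_j] := eqVneq j k.+1; last by rewrite upd_neq ?copied //; lia.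
  by rewrite upd_eq // -kept //; congr (s'.2 _); lia.
- by move=> j le_j; apply: copied; lia.
Qed.

Lemma size_output : size output <= n.+1.
Proof.
have := chain_size (best_chain valueK posK (leqnn n) (leqnn n)).
by rewrite /= size_endpoints.
Qed.

Lemma exec_matching_cmd s :
  s.1 (reg vsize) = n -> s.1 (reg vbase) = b ->
  (forall i, 0 < i <= n -> i < nreg -> s.2 (b + i) = value i) ->
  (forall i, nreg <= i <= n -> s.2 (i - nreg) = value i) ->
  let s' := exec matching_cmd s in
  [/\ s'.1 (reg vstride) = stride,
      forall j, j < size output -> s'.2 (3 * stride + j) = nth 0 output j &
      forall j, nreg <= j < size output -> s'.2 (j - nreg) = nth 0 output j].
Proof.
move=> sizeE baseE low high; rewrite /matching_cmd 5!execE.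
have vals := exec_copy_input sizeE baseE low high; set s1 := exec copy_input s in vals *.
have [size_s1 base_s1] : s1.1 (reg vsize) = n /\ s1.1 (reg vbase) = b.
  by rewrite !exec_unassigned.
have ptrs : pointers_ready (exec set_stride s1).
  by split; rewrite // execE !evalE /= size_s1 base_s1 strideE addn1 addnS.
have [lay fill] := exec_clear_boundary (exec_index_arrays ptrs vals).
have [lay' fill'] := exec_fill_table lay fill.
have [ptrs' out] := exec_trace lay' fill'.
have [stride' kept copied] := exec_copy_output ptrs'; have le_size := size_output.
by split=> // j lt_j; rewrite ?kept ?copied ?out //; lia.
Qed.

End Correctness.

(** * Freeing and restoring the registers *)

Lemma run_block_nseq_add a x k m r : x != a ->
  run_block (nseq k (IAdd a a x)) m r = if r == a then m a + k * m x else m r.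
Proof.
move=> /negPf neq_x; elim: k m => [|k IH] m /=; first by rewrite addn0; case: eqP => // ->.
by rewrite IH /upd eqxx neq_x; case: eqP => // _; lia.
Qed.

Lemma run_block_nseq_sub a x k m r : x != a ->
  run_block (nseq k (ISub a a x)) m r = if r == a then m a - k * m x else m r.
Proof.
move=> /negPf neq_x; elim: k m => [|k IH] m /=; first by rewrite subn0; case: eqP => // ->.
by rewrite IH /upd eqxx neq_x; case: eqP => // _; lia.
Qed.

Definition save_registers (k : nat) : seq instr :=
  flatten [seq [:: IAdd 0 0 1; IStore 0 r] | r <- iota 2 k].

Definition load_registers (k : nat) : seq instr :=
  flatten [seq [:: ILoad r 0; ISub 0 0 1] | r <- rev (iota 2 k)].

Lemma run_save_registers k m a : m 1 = 1 -> k < m 0 ->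
  run_block (save_registers k) m a =
    if a == 0 then m 0 + k else if m 0 < a <= m 0 + k then m (a - m 0).+1 else m a.
Proof.
move=> m1 lt_k; elim: k lt_k a => [|k IH] lt_k a.
  by rewrite /= addn0; case: eqP => [->|_] //; rewrite ifF //; lia.
rewrite /save_registers -[k.+1]addn1 iotaD map_cat flatten_cat run_block_cat /=.
rewrite -/(save_registers k).
have above1 : (m 0 < 1 <= m 0 + k) = false by lia.
have above_k : (m 0 < 2 + k <= m 0 + k) = false by lia.
rewrite /upd !IH ?(ltnW lt_k) //= above1 above_k m1 -addnA addn1.
have [->|neq_a] := eqVneq a (m 0 + k.+1).
  by rewrite ifF ?ifT ?addKn //; lia.
by rewrite (_ : (a <= m 0 + k.+1) = (a <= m 0 + k)); [case: eqP | lia].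
Qed.

Lemma run_load_registers k m a : m 1 = 1 -> k.*2 < m 0 ->
  run_block (load_registers k) m a =
    if a == 0 then m 0 - k else if 1 < a <= k.+1 then m (m 0 - k.+1 + a) else m a.
Proof.
elim: k m a => [|k IH] m a m1 lt_k.
  by rewrite /= subn0; case: eqP => [->|_] //; rewrite ifF //; lia.
rewrite /load_registers -[k.+1]addn1 iotaD rev_cat map_cat flatten_cat run_block_cat.
rewrite -/(load_registers k) IH /= /upd /= m1 ?addn1 ?subn1; try lia.
have [_|a_neq0] := eqVneq a 0; first by lia.
have [->|neq_a] := eqVneq a k.+2.
  by rewrite ltnn andbF ltnSn; congr m; lia.
rewrite (_ : (a <= k.+2) = (a <= k.+1)); last by lia.
case: ifP => // lt_a; rewrite !ifF; [congr m; lia | lia | lia].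
Qed.

(* Register 0 becomes a fresh address, at which register 1 is saved; only additions
   are involved, so that subtractions recover the size [n] from both values. *)
Definition claim_fresh (k : nat) : seq instr :=
  [:: IAdd 1 1 0] ++ nseq k (IAdd 0 0 1) ++ [:: IStore 0 1; IConst 1 1].

(* Register 2 is that of [vbase]. Heap cell [b + r] is register [fresh + r.-1], where
   register [r] has been saved, when [b] is [fresh - nreg.+1]. *)
Definition recover_size (k : nat) : seq instr :=
  [:: IConst 2 nreg.-2; ISub 0 0 2; ILoad 1 0; IConst 2 0; IAdd 2 2 0] ++
  nseq k (ISub 0 0 1) ++
  [:: ISub 1 1 0; IStore 2 1; IConst 1 nreg.+1; ISub 2 2 1].

Definition prologue : seq instr :=
  claim_fresh nreg ++ save_registers nreg.-2 ++ recover_size nreg.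

Definition fresh_address (k n p : nat) : nat := n + k * (n + p).

Lemma run_claim_fresh k m n p a : m 0 = n -> m 1 = p -> 0 < n ->
  run_block (claim_fresh k) m a =
    if a == 1 then 1 else if a == fresh_address k n p then n + p
    else if a == 0 then fresh_address k n p else m a.
Proof.
move=> m_0 m_1 n_gt0; rewrite /claim_fresh 2!run_block_cat.
set m1 := run_block (nseq _ _) _.
have m1E r : m1 r = if r == 0 then fresh_address k n p else if r == 1 then n + p else m r.
  by rewrite /m1 run_block_nseq_add //= /upd /= m_0 m_1 [p + n]addnC.
by rewrite /= /upd /= !m1E /=; case: (a =P 1) => // ->.
Qed.

Lemma run_recover_size k m n p : nreg <= fresh_address k n p ->
  m 0 = fresh_address k n p + nreg.-2 -> m (fresh_address k n p) = n + p ->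
  let m' := run_block (recover_size k) m in
  [/\ m' (reg vsize) = n, m' (reg vbase) = fresh_address k n p - nreg.+1,
      m' (fresh_address k n p) = p &
      forall a, nreg <= a -> a != fresh_address k n p -> m' a = m a].
Proof.
move=> ge_fresh m0 m_fresh; rewrite /recover_size 2!run_block_cat.
have neq_fresh r : r < nreg -> (fresh_address k n p == r) = false.
  by move=> lt_r; apply/gtn_eqF/(leq_trans lt_r).
set m1 := run_block _ m.
have m1E a : m1 a = if a == 0 then fresh_address k n p else if a == 1 then n + p
    else if a == 2 then fresh_address k n p else m a.
  rewrite /m1 /= /upd /= m0 addnK !neq_fresh // m_fresh add0n.
  by case: a => [|[|[|a]]].
set m2 := run_block _ m1.
have m2E a : m2 a = if a == 0 then n else m1 a.
  by rewrite /m2 run_block_nseq_sub // !m1E /= addnK.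
rewrite /= /upd /= !m2E !m1E /= eqxx [0 == _]eq_sym [2 == _]eq_sym !neq_fresh // addKn.
split=> // a ge_a /negPf->; rewrite m2E m1E.
by case: a ge_a => [|[|[|a]]].
Qed.

Lemma run_prologue m n p : m 0 = n -> m 1 = p -> 0 < n -> 0 < p ->
  let m' := run_block prologue m in
  [/\ m' (reg vsize) = n, m' (reg vbase) = fresh_address nreg n p - nreg.+1,
      forall r, 0 < r < nreg -> m' (fresh_address nreg n p + r.-1) = m r &
      forall a, nreg <= a < fresh_address nreg n p -> m' a = m a].
Proof.
move=> m_0 m_1 n_gt0 p_gt0; rewrite /prologue 2!run_block_cat.
have ge_fresh : nreg <= fresh_address nreg n p by rewrite /fresh_address /nreg; lia.
set fresh := fresh_address nreg n p in ge_fresh *; have nregE : nreg = 16 by [].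
have m1E a := run_claim_fresh nreg a m_0 m_1 n_gt0; rewrite -/fresh in m1E.
set m1 := run_block (claim_fresh nreg) m in m1E *; clearbody m1.
have m1_0 : m1 0 = fresh by rewrite m1E m_0 /=; case: eqP => //; lia.
have m1_1 : m1 1 = 1 by rewrite m1E.
have m2E a : run_block (save_registers nreg.-2) m1 a = if a == 0 then fresh + nreg.-2
    else if fresh < a <= fresh + nreg.-2 then m1 (a - fresh).+1 else m1 a.
  by rewrite run_save_registers // m1_0; lia.
set m2 := run_block _ m1 in m2E *; clearbody m2.
have [||m3_0 m3_2 m3_fresh m3E] := @run_recover_size nreg m2 n p ge_fresh.
- by rewrite m2E.
- by rewrite m2E -/fresh ltnn /= m1E eqxx !ifF //; lia.
rewrite -/fresh in m3_2 m3_fresh m3E; split=> // [[//|[|r]] lt_r|a lt_a].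
- by rewrite addn0 m3_fresh m_1.
- rewrite m3E ?m2E; [|lia..]; rewrite ifF ?ifT; [|lia..].
  by rewrite addKn m1E !ifF //; lia.
- by rewrite m3E ?m2E ?m1E ?ifF //; lia.
Qed.

Definition restore_registers (k : nat) : seq instr :=
  [:: IAdd 0 (reg vstride) (reg vstride); IAdd 0 0 (reg vstride);
      IConst 1 (nreg + k.+1); IAdd 0 0 1; IConst 1 1] ++
  load_registers k ++
  [:: ISub 0 0 1; IAdd 1 0 1; ILoad 1 1; ILoad 0 0].

Lemma run_restore_registers k m a : k.+2 <= nreg ->
  run_block (restore_registers k) m a =
    if a < k.+2 then m (nreg + (3 * m (reg vstride) + a)) else m a.
Proof.
move=> le_k; rewrite /restore_registers 2!run_block_cat.
set m1 := run_block _ m; set base := nreg + 3 * m 1.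
have m1E r : m1 r = if r == 0 then base + k.+1 else if r == 1 then 1 else m r.
  rewrite /m1 /= /upd /=; case: (r =P 1) => [->|_] //.
  by rewrite /base; case: eqP => // _; lia.
clearbody m1; have ge_base : k.+2 <= base by rewrite (leq_trans le_k) ?leq_addr.
have m2E r : run_block (load_registers k) m1 r =
    if r == 0 then base.+1 else if 1 < r <= k.+1 then m1 (base + r) else m1 r.
  rewrite run_load_registers !m1E //=; last by lia.
  by rewrite addnK; have -> : base + k.+1 - k = base.+1 by lia.
move: (run_block _ m1) m2E => m2 m2E.
have [base_le base_lt] : (base <= k.+1) = false /\ (base < k.+1) = false by lia.
rewrite /= /upd /= !m2E /= !m1E /= subn1 addn1 addnA -/base /= base_le base_lt.
by case: a => [|[|a]]; rewrite ?addn0 ?addn1.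
Qed.

Definition epilogue : seq instr := restore_registers nreg.-2.

Definition guarded_program (before : seq instr) (c : cmd) (after : seq instr) : seq instr :=
  let code := compile (size before).+1 c in
  IJz 0 (size before + size code + size after).+1 :: before ++ code ++ after.

Lemma guarded_program_halts before c after m :
  step (guarded_program before c after) (size (guarded_program before c after), m) = None.
Proof. by rewrite /step ltnn. Qed.

Lemma reaches_guarded0 before c after m : m 0 = 0 ->
  let p := guarded_program before c after in reaches p 1 (0, m) (size p, m).
Proof.
move=> m_0; apply: reaches_step; rewrite (code_at_step _ (code_at_whole _)).
by rewrite m_0 /= !size_cat addnA.
Qed.

Lemma reaches_guarded before c after m s :
  all straight before -> all straight after -> well_formed c ->
  m 0 != 0 -> represents (run_block before m) s ->
  let p := guarded_program before c after in
  exists2 m', represents m' (exec c s) &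
    reaches p (size p * (s.1 (reg vsize)).+1 ^ loop_depth c)
      (0, m) (size p, run_block after m').
Proof.
move=> straight_before straight_after wf_c m_0 rep p.
set code := compile (size before).+1 c.
have at_p := code_at_whole p.
have at_before := code_at_behead at_p; have at_code := code_at_catr at_before.
have run_before := reaches_block m straight_before (code_at_catl at_before).
have [m' run_code rep'] := compile_correct (code_at_catl at_code) wf_c rep.
have run_after := reaches_block m' straight_after (code_at_catr at_code).
exists m' => //.
have sizeE : size p = 1 + (size before + (size code + size after)).
  by rewrite /= !size_cat.
have -> : (size p, run_block after m') =
    (1 + size before + size code + size after, run_block after m').
  by rewrite sizeE !addnA.
have time_gt0 : 0 < (s.1 (reg vsize)).+1 ^ loop_depth c by rewrite expn_gt0.
apply: reaches_leq (reaches_trans (reaches_step _) (reaches_trans run_before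
  (reaches_trans run_code run_after))).
  apply: leq_trans (leq_add (leq_pmulr 1 time_gt0) (leq_add (leq_pmulr _ time_gt0)
    (leq_add (leqnn _) (leq_pmulr _ time_gt0)))) _.
  by rewrite -!mulnDl sizeE.
by rewrite (code_at_step _ at_p) (negPf m_0).
Qed.

Definition encodes (m : memory) (l : seq (nat * nat)) : Prop :=
  forall j, j < size (encoding l) -> m j = nth 0 (encoding l) j.

Definition matching_program : seq instr := guarded_program prologue matching_cmd epilogue.

Section Permutation.
Variables (n : nat) (pi : {perm 'I_n}).

Local Notation longest_chain := (best (init_mem pi) (position pi) n n).

Lemma run_prologue_init_mem : 0 < n ->
  let m := run_block prologue (init_mem pi) in
  exists2 b, n < b &
    [/\ m (reg vsize) = n, m (reg vbase) = b,
        forall i, 0 < i <= n -> i < nreg -> m (nreg + (b + i)) = init_mem pi i &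
        forall i, nreg <= i <= n -> m i = init_mem pi i].
Proof.
move=> n_gt0; have nregE : nreg = 16 by [].
have [/andP[p_gt0 _] _] := init_memK pi (i := 1) n_gt0.
have := @run_prologue (init_mem pi) n _ erefl erefl n_gt0 p_gt0.
set fresh := fresh_address _ _ _ => -[sizeE baseE low high].
have fresh_ge : n + 32 <= fresh by rewrite /fresh /fresh_address nregE; lia.
exists (fresh - nreg.+1); first by rewrite nregE; lia.
split=> // i lt_i; last by apply: high; lia.
by move=> lt_i_nreg; rewrite -low; [congr run_block; rewrite nregE | ]; lia.
Qed.

Lemma reaches_matching_program : exists2 m,
  reaches matching_program (size matching_program * n.+1 ^ 2)
    (0, init_mem pi) (size matching_program, m) &
  encodes m longest_chain.
Proof.
have [n0|n_gt0] := posnP n.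
  exists (init_mem pi); last first.
    rewrite /encodes (congr2 (best (init_mem pi) (position pi)) n0 n0) best_row0.
    by case.
  apply: reaches_leq (reaches_guarded0 _ _ _ n0).
  by rewrite muln_gt0 expn_gt0.
have [b lt_b [sizeE baseE low high]] := run_prologue_init_mem n_gt0.
set m0 := run_block _ _ in sizeE baseE low high.
set s : state := (m0, fun a => m0 (nreg + a)); have rep : represents m0 s by [].
have [m rep_m run_m] := reaches_guarded (before := prologue) (after := epilogue)
  (m := init_mem pi) isT isT well_formed_matching_cmd (lt0n_neq0 n_gt0) rep.
clearbody m0.
have [|strideE out_heap out_low] :=
  exec_matching_cmd (s := s) lt_b (init_memK pi) (positionK pi) sizeE baseE low.
  by move=> i lt_i; rewrite -high // /s /= subnKC //; case/andP: lt_i.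
exists (run_block epilogue m).
  by rewrite (sizeE : s.1 (reg vsize) = n) loop_depth_matching_cmd in run_m.
have [rep_var rep_heap] := rep_m.
move=> j lt_j; rewrite run_restore_registers //; case: ltnP => lt_j_nreg.
  by rewrite rep_heap rep_var // strideE out_heap.
by rewrite -[j in m j](subnKC lt_j_nreg) rep_heap out_low // lt_j_nreg.
Qed.

Lemma encodes_size m l : encodes m l -> m 0 = size l.
Proof. by move=> enc; rewrite enc. Qed.

Lemma encodes_nth m l j : encodes m l -> j < size l ->
  (m j.*2.+1, m j.*2.+2) = nth (0, 0) l j.
Proof. by move=> enc lt_j; rewrite !enc ?nth_endpoints //= size_endpoints; lia. Qed.

Lemma encodes_output_wf m l :
  encodes m l -> chain (position pi) n n l -> output_wf n m.
Proof.
move=> enc ch i; rewrite (encodes_size enc) => lt_i.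
by have := mem_nth (0, 0) lt_i; rewrite -(encodes_nth enc lt_i) => /(chain_mem ch); lia.
Qed.

Lemma encodes_decode_output m l :
  encodes m l -> chain (position pi) n n l -> decode_output n m = edges_of n l.
Proof.
move=> enc ch; have size_l := encodes_size enc; apply/setP=> e; rewrite !inE.
apply/existsP/mapP => [[i /existsP[u /existsP[v /and3P[/eqP eq_u /eqP eq_v /eqP->]]]]|].
  have lt_i : i < size l by rewrite -size_l.
  exists (nth (0, 0) l i); first exact: mem_nth.
  by rewrite -edge_ofE eq_u eq_v (encodes_nth enc lt_i).
case=> -[w x] wx_l ->; have [lt_w lt_x] := chain_mem ch wx_l.
have lt_i : index (w, x) l < m 0 by rewrite size_l index_mem.
have [u eq_u] : exists u : 'I_n, w = u.+1 by apply: ord_of_pos; lia.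
have [v eq_v] : exists v : 'I_n, x = v.+1 by apply: ord_of_pos; lia.
exists (Ordinal lt_i); apply/existsP; exists u; apply/existsP; exists v.
have := encodes_nth enc (j := index (w, x) l); rewrite index_mem nth_index // => /(_ wx_l).
by move=> /= [-> ->]; rewrite eq_u eq_v edge_ofE !eqxx.
Qed.

Lemma best_maximum_induced_matching :
  maximum_induced_matching pi (edges_of n longest_chain).
Proof.
have ch := best_chain (init_memK pi) (positionK pi) (leqnn n) (leqnn n).
have [ind card _] := chain_edges (leqnn n) ch; split=> // M ind_M.
have [|l ch_l <-] := matching_chain (i := n) (v := n) ind_M; first by split.
by rewrite card; exact: (best_max (positionK pi) (leqnn n) (leqnn n) ch_l).
Qed.

End Permutation.

Lemma sqrnS_leq n : n.+1 ^ 2 <= 2 * (n ^ 2).+1.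
Proof. by have := (nat_Cauchy n 1).1; rewrite -[n.+1]addn1 sqrnD; lia. Qed.

Theorem theorem1 :
  exists (p : seq instr) (c : nat),
    forall (n : nat) (pi : {perm 'I_n}),
      exists m : memory,
        run p (c * n ^ 2 + c) (0, init_mem pi) = Some m /\
        output_wf n m /\
        maximum_induced_matching pi (decode_output n m).
Proof.
exists matching_program, (2 * size matching_program) => n pi.
have [m reach enc] := reaches_matching_program pi.
have ch := best_chain (init_memK pi) (positionK pi) (leqnn n) (leqnn n).
exists m; split; last split.
- apply: reaches_run (guarded_program_halts _ _ _ _); apply: reaches_leq reach.
  apply: leq_trans (leq_mul (leqnn _) (sqrnS_leq n)) _.
  by rewrite mulnCA mulnA mulnS addnC.
- exact: encodes_output_wf enc ch.
- by rewrite (encodes_decode_output enc ch); apply: best_maximum_induced_matching.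
Qed.
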